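(* Suppose that $\nabla_\pi D(\pi,\omega)$ and $\lambda$ are uncorrelated. Under the tariff $T^*_{\mathrm{dec}}$, customer-integrated distributed energy resources induce an expected total surplus $$\overline{\mathrm{sw}}(T^*_{\mathrm{dec}})=\overline{\mathrm{sw}}^*_0+\sum_{i=1}^M\Big(V^{\mathrm S}(\overline\lambda,\theta^i)+\mathbb{E}[\lambda^{\top}r^i(\omega^i)]\Big)$$ that is independent of $F$, and an expected consumer surplus $$\overline{\mathrm{cs}}(T^*_{\mathrm{dec}})=\overline{\mathrm{cs}}_0(T^* )+\sum_{i=1}^M\Big(V^{\mathrm S}(\overline\lambda,\theta^i)+\mathbb{E}[\lambda^{\top}r^i(\omega^i)]\Big).$$
   Context: A billing cycle has $N$ periods and there are $M$ customers. Customer $i$ has a random local state $\omega^i=(\omega^i_1,\dots,\omega^i_N)\in\mathbb{R}^N$; $\omega=(\omega^1,\dots,\omega^M)$. The random vector of wholesale prices is $\lambda\in\mathbb{R}^N$, with mean $\overline\lambda=\mathbb{E}[\lambda]$, and $\xi=(\lambda,\omega)$. All expectations appearing are assumed to exist and be finite. $\operatorname{Cov}(X,Y)=\mathbb{E}[(X-\mathbb{E}X)(Y-\mathbb{E}Y)^{\top}]$. $F\in\mathbb{R}$ is a constant (the retailer's non-energy costs); ''independent of $F$'' means the value is the same for every $F$, all other data being fixed. Demand: $S^i(q,\omega^i)\in\mathbb{R}$ is the gross benefit of customer $i$ from consuming the profile $q\in\mathbb{R}^N$. A policy $\omega^i\mapsto q(\omega^i)\in\mathbb{R}^N$ is causal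 if its $k$-th component depends only on $\omega^i_1,\dots,\omega^i_k$. For each price vector $\pi\in\mathbb{R}^N$, the demand function $\omega^i\mapsto D^i(\pi,\omega^i)$ is the causal policy maximizing $\mathbb{E}[S^i(q(\omega^i),\omega^i)-\pi^{\top}q(\omega^i)]$. It is assumed that $D^i(\cdot,\omega^i)$ is nonnegative, continuously differentiable in $\pi$, with negative definite Jacobian $\nabla_\pi D^i(\pi,\omega^i)\in\mathbb{R}^{N\times N}$. Let $D(\pi,\omega)=\sum_{i=1}^M D^i(\pi,\omega^i)$. Standing assumption: $g(\pi)=\mathbb{E}[\nabla_\pi D(\pi,\omega)(\pi-\lambda)]$ has a negative definite Jacobian matrix $\nabla g(\pi)$. ''$\nabla_\pi D(\pi,\omega)$ and $\lambda$ are uncorrelated'' means that, for each $\pi$, every entry of $\nabla_\pi D(\pi,\omega)$ is uncorrelated with every entry of $\lambda$. Storage: for a capacity $\theta\ge 0$, the feasible discharge vectors are $\mathcal{U}(\theta)=\{s\in\mathbb{R}^N: 0\le-\sum_{t=1}^k s_t\le\theta,\ k=1,\dots,N\}$. For $\pi\in\mathbb{R}^N$, $V^{\mathrm S}(\pi,\theta)=\max\{\pi^{\top}s: s\in\mathcal{U}(\theta)\}$, and $s^*(\pi,\theta)$ denotes an optimal solution of this maximization. Decentralized integration (net metering): customer $i$ has a state-contingent renewable profile $r^i(\omega^i)\in\mathbb{R}^N_+$ available at no cost and storage of capacity $\theta^i\ge0$; $r(\omega)=\sum_{i=1}^M r^i(\omega^i)$. With consumption $q^i$ and storage discharge $s^i$,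 net demand is $d^i=q^i-r^i-s^i$, and the tariff is charged on $d^i$. The expected surplus of customer $i$ under a tariff $T$ is $$\overline{\mathrm{cs}}^i(T)=\max_{q^i(\cdot),s^i(\cdot)\text{ causal}}\mathbb{E}\big[S^i(q^i(\omega^i),\omega^i)-T(d^i(\omega^i))\big]\quad\text{s.t. } s^i(\omega^i)\in\mathcal{U}(\theta^i).$$ For $T(d)=A+\pi^{\top}d$ the optimal choices are $q^i=D^i(\pi,\omega^i)$ and $s^i=s^*(\pi,\theta^i)$, with net demand $d^i(\pi,\omega^i)=D^i(\pi,\omega^i)-r^i(\omega^i)-s^*(\pi,\theta^i)$. Put $\overline{\mathrm{cs}}(T)=\sum_{i=1}^M\overline{\mathrm{cs}}^i(T)$, $\overline{\mathrm{rs}}(T)=\mathbb{E}\big[\sum_{i=1}^M\big(T(d^i(\pi,\omega^i))-\lambda^{\top}d^i(\pi,\omega^i)\big)\big]$ and $\overline{\mathrm{sw}}(T)=\overline{\mathrm{cs}}(T)+\overline{\mathrm{rs}}(T)$. The tariff $T^*_{\mathrm{dec}}(d)=A^*_{\mathrm{dec}}+\pi^{*\top}_{\mathrm{dec}}d$ is the two-part tariff solving $\max_T\overline{\mathrm{cs}}(T)$ subject to $\overline{\mathrm{rs}}(T)=F$ over two-part tariffs; when $\nabla_\pi D(\pi,\omega)$ and $\lambda$ are uncorrelated it is given by $\pi^*_{\mathrm{dec}}=\overline\lambda$ and $A^*_{\mathrm{dec}}=A^*-\frac1M\operatorname{Tr}(\operatorname{Cov}(\lambda,r(\omega)))$ with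 $A^*=\frac1M\big(F+\operatorname{Tr}(\operatorname{Cov}(\lambda,D(\overline\lambda,\omega)))\big)$. Benchmark without distributed energy resources (subscript $0$): for $T(q)=A+\pi^{\top}q$, $\overline{\mathrm{cs}}_0(T)=\sum_{i=1}^M\mathbb{E}[S^i(D^i(\pi,\omega^i),\omega^i)-\pi^{\top}D^i(\pi,\omega^i)]-MA$ and $\overline{\mathrm{rs}}_0(T)=MA+\sum_{i=1}^M\mathbb{E}[(\pi-\lambda)^{\top}D^i(\pi,\omega^i)]$. $T^*(q)=A^*+\pi^{*\top}q$ is the optimal two-part tariff for $\max_T\overline{\mathrm{cs}}_0(T)$ subject to $\overline{\mathrm{rs}}_0(T)=F$; under the uncorrelatedness condition $\pi^*=\overline\lambda$ and $A^*=\frac1M\big(F+\operatorname{Tr}(\operatorname{Cov}(\lambda,D(\overline\lambda,\omega)))\big)$. Finally, $\overline{\mathrm{sw}}^*_0=\sum_{i=1}^M\mathbb{E}[S^i(D^i(\pi^*,\omega^i),\omega^i)-\lambda^{\top}D^i(\pi^*,\omega^i)]$, so that $\overline{\mathrm{cs}}_0(T^* )=\overline{\mathrm{sw}}^*_0-F$. *)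

(* Defs.v *)
From HB Require Import structures.
From mathcomp Require Export all_boot all_order all_algebra.
From mathcomp Require Export all_classical all_reals all_analysis.
Export Order.TTheory GRing.Theory Num.Theory.
Export numFieldNormedType.Exports.
Set Implicit Arguments.
Unset Strict Implicit.
Unset Printing Implicit Defensive.
Local Open Scope classical_set_scope.
Local Open Scope ring_scope.

Section Vectors.
Context {R : realType} {N : nat}.

Definition dot (u v : 'rV[R]_N) : R := (u *m v^T) 0 0.

(* No symmetry is required: the Jacobian of a causal demand need not be
   symmetric. *)
Definition neg_def (A : 'M[R]_N) : Prop :=
  forall v : 'rV[R]_N, v != 0 -> dot (v *m A) v < 0.

Definition causal (q : 'rV[R]_N -> 'rV[R]_N) : Prop :=
  forall (k : 'I_N) (x y : 'rV[R]_N),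
    (forall j : 'I_N, (j <= k)%N -> x 0 j = y 0 j) -> q x 0 k = q y 0 k.

End Vectors.

Notation borel R N := (g_sigma_algebraType (@open 'rV[R]_N)).

Definition policy (R : realType) (N : nat) (q : 'rV[R]_N -> 'rV[R]_N) : Prop :=
  measurable_fun [set: borel R N] (q : borel R N -> borel R N) /\ causal q.

Section Storage.
Context {R : realType} {N : nat}.

Definition discharge (theta : R) : set 'rV[R]_N :=
  [set s | forall k : 'I_N, 0 <= - (\sum_(t < N | (t <= k)%N) s 0 t) <= theta].

(* The set is bounded and the supremum is attained when [0 <= theta]. *)
Definition VS (p : 'rV[R]_N) (theta : R) : R :=
  sup [set dot p s | s in discharge theta].

End Storage.

Record two_part (R : realType) (N : nat) :=
  TwoPart { access : R ; price : 'rV[R]_N }.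

Definition charge (R : realType) (N : nat) (t : two_part R N) (x : 'rV[R]_N) : R :=
  access t + dot (price t) x.

(* [lam] and [om i] are random vectors on the sample space [T]; [benefit i],
   [dem i p] and [ren i] take a value of the local state of customer [i];
   [sstar p th] is the selected optimal discharge at prices [p] and capacity [th]. *)
Record market (T : Type) (R : realType) (N M : nat) := Market {
  lam : T -> 'rV[R]_N ;
  om : 'I_M -> T -> 'rV[R]_N ;
  benefit : 'I_M -> 'rV[R]_N -> 'rV[R]_N -> R ;
  dem : 'I_M -> 'rV[R]_N -> 'rV[R]_N -> 'rV[R]_N ;
  ren : 'I_M -> 'rV[R]_N -> 'rV[R]_N ;
  theta : 'I_M -> R ;
  sstar : 'rV[R]_N -> R -> 'rV[R]_N
}.

Section Market.
Context {d : measure_display} {T : measurableType d} {R : realType}.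
Context (P : probability T R) {N M : nat} (m : market T R N M).
Implicit Types (p : 'rV[R]_N) (t : two_part R N) (i : 'I_M) (w : T).

Definition has_mean (X : T -> R) : Prop := P.-integrable [set: T] (EFin \o X).

Definition mean (X : T -> R) : R := fine ('E_P[X])%E.

Definition mean_price : 'rV[R]_N := \row_k mean (fun w => lam m w 0 k).

Definition demand i p w : 'rV[R]_N := dem m i p (om m i w).

Definition total_demand p w : 'rV[R]_N := \sum_i demand i p w.

(* Entry (l, k) is the derivative of the [k]-th demand with respect to the
   [l]-th price: this is the layout of ['J] on row vectors, and the one for which
   [foc] below is the gradient of the expected total surplus. *)
Definition grad_demand p w : 'M[R]_N := 'J (fun p' => total_demand p' w) p.

Definition foc p : 'rV[R]_N :=
  \row_l mean (fun w => (grad_demand p w *m (p - lam m w)^T) l 0).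

(* [Pi] is the set of admissible prices, [setT] being the unrestricted case: with
   nonnegative demand and uncorrelated prices, [foc_regular_on] below cannot hold
   on all of [setT]. *)
Definition uncorrelated_on (Pi : set 'rV[R]_N) : Prop :=
  forall p, Pi p -> forall l k j : 'I_N,
    covariance P (fun w => grad_demand p w l k) (fun w => lam m w 0 j) = 0%E.

Definition random_data : Prop :=
  [/\ measurable_fun [set: T] (lam m : T -> borel R N),
      forall i, measurable_fun [set: T] (om m i : T -> borel R N) &
      forall i, measurable_fun [set: borel R N]
                  (ren m i : borel R N -> borel R N)].

Definition benefit_net i p (q : 'rV[R]_N -> 'rV[R]_N) w : R :=
  benefit m i (q (om m i w)) (om m i w) - dot p (q (om m i w)).

Definition admissible i p (q : 'rV[R]_N -> 'rV[R]_N) : Prop :=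
  policy q /\ has_mean (benefit_net i p q).

Definition demand_optimal_on (Pi : set 'rV[R]_N) : Prop :=
  forall i p, Pi p -> admissible i p (dem m i p) /\
    forall q, admissible i p q ->
      mean (benefit_net i p q) <= mean (benefit_net i p (dem m i p)).

Definition demand_regular_on (Pi : set 'rV[R]_N) : Prop :=
  forall i w p, Pi p ->
    [/\ forall k, 0 <= demand i p w 0 k,
        differentiable (fun p' => demand i p' w) p,
        {for p, continuous (fun p' => 'J (fun p'' => demand i p'' w) p')} &
        neg_def ('J (fun p' => demand i p' w) p)].

(* Finiteness of the first moments and of the mixed moments that enter the
   covariances and surpluses; the moments involving [benefit] are part of
   [admissible]. *)
Definition finite_moments_on (Pi : set 'rV[R]_N) : Prop :=
  [/\ forall j, has_mean (fun w => lam m w 0 j),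
      forall i k, has_mean (fun w => ren m i (om m i w) 0 k) /\
        forall j, has_mean (fun w => lam m w 0 j * ren m i (om m i w) 0 k),
      forall i p, Pi p -> forall k, has_mean (fun w => demand i p w 0 k) /\
        forall j, has_mean (fun w => lam m w 0 j * demand i p w 0 k) &
      forall p, Pi p -> forall l k, has_mean (fun w => grad_demand p w l k) /\
        forall j, has_mean (fun w => lam m w 0 j * grad_demand p w l k)].

Definition foc_regular_on (Pi : set 'rV[R]_N) : Prop :=
  forall p, Pi p -> differentiable foc p /\ neg_def ('J foc p).

Definition resources : Prop :=
  [/\ forall i, 0 <= theta m i,
      forall i w k, 0 <= ren m i (om m i w) 0 k &
      forall p th, 0 <= th -> discharge th (sstar m p th) /\
        forall s, discharge th s -> dot p s <= dot p (sstar m p th)].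

(* Customers with distributed resources, for an arbitrary tariff [tau]. *)
Definition payoff i (tau : 'rV[R]_N -> R) (q s : 'rV[R]_N -> 'rV[R]_N) w : R :=
  let x := om m i w in benefit m i (q x) x - tau (q x - ren m i x - s x).

Definition feasible i (tau : 'rV[R]_N -> R)
    (q s : 'rV[R]_N -> 'rV[R]_N) : Prop :=
  [/\ policy q, policy s, forall w, discharge (theta m i) (s (om m i w)) &
      has_mean (payoff i tau q s)].

(* The supremum is a maximum whenever an optimal choice exists. *)
Definition cs_customer i (tau : 'rV[R]_N -> R) : R :=
  sup [set c | exists q s, feasible i tau q s /\ c = mean (payoff i tau q s)].

Definition net_demand i p w : 'rV[R]_N :=
  demand i p w - ren m i (om m i w) - sstar m p (theta m i).

Definition cs t : R := \sum_i cs_customer i (charge t).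

Definition rs t : R :=
  mean (fun w => \sum_i (charge t (net_demand i (price t) w) -
                         dot (lam m w) (net_demand i (price t) w))).

Definition sw t : R := cs t + rs t.

Definition cs0 t : R :=
  (\sum_i mean (benefit_net i (price t) (dem m i (price t)))) - M%:R * access t.

Definition rs0 t : R :=
  M%:R * access t +
  \sum_i mean (fun w => dot (price t - lam m w) (demand i (price t) w)).

Definition sw0 p : R :=
  \sum_i mean (fun w => benefit m i (demand i p w) (om m i w) -
                        dot (lam m w) (demand i p w)).

Definition optimal_tariff (Pi : set 'rV[R]_N) (cs rs : two_part R N -> R)
    (F : R) t : Prop :=
  [/\ Pi (price t), rs t = F &
      forall t', Pi (price t') -> rs t' = F -> cs t' <= cs t].

End Market.

(* Main.v *)
Require Import Defs.
From HB Require Import structures.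
From mathcomp Require Import ring lra measurable_realfun.
Set Implicit Arguments.
Unset Strict Implicit.
Unset Printing Implicit Defensive.
Local Open Scope classical_set_scope.
Local Open Scope ring_scope.

(** Why the result holds. Summing the surplus of customers and retailer, payments cancel and
    the total surplus under a price [p] is
    [sw0 p + \sum_i (mean_price . sstar p (theta i) + mean (lam . r i))] ([swE]). The
    storage term is largest at [p = mean_price], where it equals [VS mean_price (theta i)].
    [sw0] is largest there too ([sw0_le_mean_price]): demand is optimal for the customers at
    the price they face, hence [sw0 p <= sw0 mean_price] up to the change between [p] and
    [mean_price] of the sum of the covariances of demand and wholesale price, and these
    covariances do not change. As the access charge transfers surplus without loss, an
    optimal two-part tariff reaches the maximal total surplus, whatever the revenue target;
    subtracting the target gives the consumer surplus.

    The analytic core is that the covariances of [lam] and [D p] do not depend on [p]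
    ([weighted_mean_constant]). The gradient of [D] is uncorrelated with [lam], but for each
    price separately and without any domination, so the derivative and the expectation cannot
    simply be exchanged: this needs [`|lam| * `|grad D|] to be integrable jointly in the
    state and along a path of prices. Monotonicity of demand supplies it.
    In the direction of its own price a component of demand is decreasing, and the integral
    of its derivative is an increment. For the other directions, consider the section of [D] by a
    plane: a monotone map [(u, v)] of a square, of size at most [K]. Its Jacobian
    determinant dominates a quarter of the square of [uy - vx], while a weighted integral of the
    determinant is a weighted integral of terms that are linear in the derivatives
    ([integral_jacobian_form]). Absorbing them bounds the integral of [`|uy|], inside the
    square, by a multiple of [K] ([weighted_cross_derivative_bound]): this is the fact that
    monotone maps have locally bounded variation. The size [K] is itself controlled by
    demand at four prices ([field_bound]), which has finite moments. Tonelli's theorem then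
    provides lines along which Fubini's theorem applies ([cross_invariance]). *)

(** * Measurability and translations of the plane *)

Section JointMeasurability.
Context d (T : measurableType d) (R : realType).

(** [f w x] is the limit of [f w (floor (n x) / n)], and these approximations are
    measurable because they glue countably many functions of [w] alone. *)
Lemma measurable_separately_continuous (f : T -> R -> R) :
  (forall x, measurable_fun setT (f^~ x)) -> (forall w, continuous (f w)) ->
  measurable_fun setT (fun z : T * R => f z.1 z.2).
Proof.
move=> mf cf.
pose r (n : nat) (x : R) : R := (Num.floor (x * n.+1%:R))%:~R / n.+1%:R.
have rcvg x : r ^~ x @ \oo --> x.
  apply/cvgrPdist_le => e e0; near=> n.
  have n0 : 0 < n.+1%:R :> R by rewrite ltr0n.
  have /andP[h1 h2] := floor_itv (x * n.+1%:R).
  have -> : x - r n x = (x * n.+1%:R - (Num.floor (x * n.+1%:R))%:~R) / n.+1%:R.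
    by rewrite mulrBl mulfK// gt_eqF.
  rewrite ger0_norm; last by rewrite divr_ge0 ?subr_ge0 ?ler0n.
  apply: (@le_trans _ _ n.+1%:R^-1).
    rewrite ler_pdivrMr// mulVf ?gt_eqF// lerBlDr addrC.
    by move: h2; rewrite intrD => /ltW.
  by near: n; apply: filterS (near_infty_natSinv_lt (PosNum e0)) => n; exact: ltW.
apply: (@measurable_fun_cvg _ _ _ _ (fun n (z : T * R) => f z.1 (r n z.2))).
  move=> n _ B mB; rewrite setTI.
  have -> : (fun z : T * R => f z.1 (r n z.2)) @^-1` B =
    \bigcup_(k : int) ((f^~ (k%:~R / n.+1%:R) @^-1` B) `*`
       ((fun x : R => x * n.+1%:R) @^-1` `[k%:~R, (k + 1)%:~R[%classic)).
    apply/seteqP; split => [[w x] /= h|[w x] /= [k _] [/= h]].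
      by exists (Num.floor (x * n.+1%:R)) => //; split => //=; rewrite in_itv/= floor_itv.
    by rewrite in_itv/= => /floor_def; rewrite /r => ->.
  apply: countable_bigcupT_measurable => // k.
  apply: measurableX; first by rewrite -[X in measurable X]setTI; exact: mf.
  rewrite -[X in measurable X]setTI.
  have : measurable_fun setT (fun x : R => x * n.+1%:R) by exact: measurable_funM.
  by apply.
move=> [w x] _ /=.
exact: (continuous_cvg _ (cf w x) (rcvg x)).
Unshelve. all: by end_near. Qed.

End JointMeasurability.

Section Translation.
Context {R : realType}.
Local Notation leb := (@lebesgue_measure R).

(** Translations are typed on [measurableTypeR R], the type for which the pushforward
    of Lebesgue measure is found by inference. *)
Definition shift (h : R) (x : measurableTypeR R) : measurableTypeR R := x + h.

Lemma measurable_shift h : measurable_fun setT (shift h).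
Proof. by apply: measurable_funD => //; exact: measurable_cst. Qed.

HB.instance Definition _ h :=
  isMeasurableFun.Build _ _ _ _ (shift h) (measurable_shift h).

Lemma lebesgue_measure_translation (h : R) (A : set R) : measurable A ->
  pushforward leb (shift h) A = leb A.
Proof.
move=> mA; apply/esym/lebesgue_measure_unique => //= _ [[a b]] _ <-.
rewrite /pushforward.
have -> : shift h @^-1` `]a, b]%classic = `]a - h, b - h]%classic.
  by apply/seteqP; split => x /=; rewrite !in_itv/= ltrBlDr lerBrDr.
rewrite !lebesgue_measure_itv/= !lte_fin ltrD2r.
by case: ifP => // _; rewrite -!EFinB; congr (_%:E); ring.
Qed.

Local Notation leb2 := (leb \x leb)%E.

Local Notation plane := (measurableTypeR R * measurableTypeR R)%type.

Definition translate (h : R * R) (z : plane) : plane := (shift h.1 z.1, shift h.2 z.2).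

Lemma measurable_translate h : measurable_fun setT (translate h).
Proof.
apply: measurable_fun_pair; apply: measurableT_comp => //; exact: measurable_shift.
Qed.

HB.instance Definition _ h :=
  isMeasurableFun.Build _ _ _ _ (translate h) (measurable_translate h).

Lemma lebesgue2_measure_translation h (A : set plane) :
  measurable A -> pushforward leb2 (translate h) A = leb2 A.
Proof.
move=> mA.
apply/esym.
apply: (@product_measure_unique _ _ _ _ _ _ _ (pushforward leb2 (translate h))) => // B C mB mC.
rewrite /pushforward.
have mt (k : R) (D : set R) : measurable D -> measurable (shift k @^-1` D).
  move=> mD; rewrite -[X in measurable X]setTI; exact: (measurable_shift k).
transitivity ((leb2)%E ((shift h.1 @^-1` B) `*` (shift h.2 @^-1` C))); first by [].
rewrite product_measure1E; [|exact: mt|exact: mt].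
by congr (_ * _)%E; exact: lebesgue_measure_translation.
Qed.

Lemma integral_translate h (f : plane -> R) :
  measurable_fun setT f ->
  leb2.-integrable setT (EFin \o (f \o translate h)) ->
  (\int[leb2]_z f (translate h z) = \int[leb2]_z f z)%R.
Proof.
move=> mf intf; rewrite /Rintegral; congr fine.
transitivity (\int[pushforward leb2 (translate h)]_z (f z)%:E)%E.
  rewrite (integral_pushforward (measurable_translate h) (f := EFin \o f))//.
  exact/measurable_EFinP.
by apply: eq_measure_integral => //= A mA _; exact: lebesgue2_measure_translation.
Qed.

End Translation.

Section Segment.
Context {R : realType}.
Implicit Types (f : R -> R).

(** Functions on the unit square are extended to the plane by clamping their arguments:
    this keeps them continuous and Lipschitz, so that the translation invariance of
    integrals over the whole plane can be used without leaving their domain. *)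
Definition clamp (x : R) : R := Num.max 0 (Num.min x 1).

Lemma clamp_ge0 x : 0 <= clamp x.
Proof. by rewrite /clamp le_max lexx. Qed.

Lemma clamp_le1 x : clamp x <= 1.
Proof. by rewrite /clamp ge_max ler01/= ge_min lexx orbT. Qed.

Lemma clamp_id x : 0 <= x <= 1 -> clamp x = x.
Proof. by move=> /andP[x0 x1]; rewrite /clamp (min_idPl x1) (max_idPr x0). Qed.

Lemma clamp_lt0 x : x <= 0 -> clamp x = 0.
Proof. by move=> x0; rewrite /clamp; apply/max_idPl; rewrite ge_min x0. Qed.

Lemma clamp_gt1 x : 1 <= x -> clamp x = 1.
Proof. by move=> x0; rewrite /clamp (min_idPr x0); apply/max_idPr. Qed.

Lemma clampK x : clamp (clamp x) = clamp x.
Proof. by rewrite clamp_id// clamp_ge0 clamp_le1. Qed.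

Lemma clampP x : [\/ x <= 0 /\ clamp x = 0, 0 <= x <= 1 /\ clamp x = x |
  1 <= x /\ clamp x = 1].
Proof.
have [x0|/ltW x0] := leP x 0; first by apply: Or31; rewrite clamp_lt0.
have [x1|/ltW x1] := leP 1 x; first by apply: Or33; rewrite clamp_gt1.
by apply: Or32; rewrite clamp_id x0 x1.
Qed.

Lemma clamp_lipschitz x y : `|clamp x - clamp y| <= `|x - y|.
Proof.
wlog yx : x y / y <= x.
  by move=> h; have [/h//|/ltW/h] := leP y x; rewrite distrC [in X in _ <= X]distrC.
rewrite [leRHS]ger0_norm ?subr_ge0// ler_norml.
apply/andP; case: (clampP x) => -[+ ->]; case: (clampP y) => -[+ ->];
  do ?[move=> /andP[]]; move=> *; do ?[match goal with H : is_true (_ && _) |- _ =>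
  move/andP: H => [] * end]; split; lra.
Qed.

Lemma continuous_lipschitz f (c : R) : (forall x y, `|f x - f y| <= c * `|x - y|) -> continuous f.
Proof.
move=> fl x; apply/cvgrPdist_le => e e0.
have c0 : 0 <= c.
  by have := fl 0 1; rewrite sub0r normrN normr1 mulr1; exact: le_trans.
have c1 : 0 < c + 1 by rewrite ltr_wpDl.
near=> y; apply: (le_trans (fl x y)).
apply: (@le_trans _ _ ((c + 1) * `|x - y|)); first by rewrite ler_wpM2r// lerDl.
rewrite mulrC -ler_pdivlMr//; near: y.
have /cvgrPdist_le : y @[y --> x] --> x by exact: cvg_id.
by apply; rewrite divr_gt0.
Unshelve. all: by end_near. Qed.

Lemma continuous_clamp : continuous clamp.
Proof. by apply: (@continuous_lipschitz _ 1) => x y; rewrite mul1r clamp_lipschitz. Qed.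

(** The mean value theorem gives the bound on the unit segment, and clamping is
    1-Lipschitz. *)
Lemma clamped_lipschitz f (df : R -> R) (c : R) : (forall x, f (clamp x) = f x) -> continuous f ->
  (forall x : R, 0 < x < 1 -> is_derive x 1 f (df x)) ->
  (forall x, `|df x| <= c) -> forall x y : R, `|f x - f y| <= c * `|x - y|.
Proof.
move=> fc cf dff dfc.
have c0 : 0 <= c by exact: le_trans (dfc 0).
have main x y : 0 <= x -> x <= y -> y <= 1 -> `|f x - f y| <= c * `|x - y|.
  move=> x0; rewrite le_eqVlt => /predU1P[->|xy] y1.
    by rewrite !subrr normr0 mulr0.
  have dxy z : z \in `]x, y[%R -> is_derive z 1 f (df z).
    rewrite in_itv/= => /andP[xz zy]; apply: dff.
    by rewrite (le_lt_trans x0 xz) (lt_le_trans zy y1).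
  have [z _ fz] := MVT xy dxy (continuous_subspaceT cf).
  by rewrite distrC fz normrM [`|x - y|]distrC ler_wpM2r.
move=> x y; rewrite -(fc x) -(fc y).
apply: (@le_trans _ _ (c * `|clamp x - clamp y|)); last first.
  by rewrite ler_wpM2l// clamp_lipschitz.
have [xy|/ltW xy] := leP (clamp x) (clamp y).
  by apply: main => //; rewrite ?clamp_ge0 ?clamp_le1.
rewrite distrC [X in c * X]distrC.
by apply: main => //; rewrite ?clamp_ge0 ?clamp_le1.
Qed.

End Segment.

(** * The Jacobian determinant is a null Lagrangian *)

Section Quotients.
Context {R : realType}.
Implicit Types (f : R -> R).

Lemma cvg_difference_quotient f (x df : R) (h : R^nat) :
  is_derive x 1 f df -> (forall n, h n != 0) -> h @ \oo --> (0 : R) ->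
  (fun n => (h n)^-1 * (f (x + h n) - f x)) @ \oo --> df.
Proof.
move=> fdf h0 hcvg.
have dfx : h^-1 *: (f (h *: 1 + x) - f x) @[h --> 0^'] --> df.
  by rewrite -(@derive_val _ _ _ _ _ _ _ fdf); exact: ex_derive.
have hc : h @ \oo --> 0^'.
  move=> A [e /= e0 eA]; change (\forall n \near \oo, A (h n)).
  near=> n; apply: eA => /=; last exact: h0.
  by near: n; move/cvgrPdist_lt : hcvg; exact.
have := cvg_comp _ _ hc dfx.
apply: cvg_trans; apply: near_eq_cvg; near=> n => /=.
by rewrite [h n *: 1](mulr1 (h n)) [h n + x]addrC.
Unshelve. all: by end_near. Qed.

Lemma cvg_bounded0 (a b : R^nat) (c : R) : (forall n, `|a n| <= c) ->
  b @ \oo --> (0 : R) -> (fun n => a n * b n) @ \oo --> (0 : R).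
Proof.
move=> ac b0; apply/norm_cvg0P => /=.
apply: (@squeeze_cvgr _ _ _ _ (cst 0) (fun n => c * `|b n|)).
- by near=> n; rewrite normr_ge0 /= normrM ler_wpM2r.
- exact: cvg_cst.
rewrite -[X in _ --> X](mulr0 c); apply: cvgMr.
by apply/norm_cvg0P.
Unshelve. all: by end_near. Qed.

Definition inv_succ (n : nat) : R := n.+1%:R^-1.

Lemma inv_succ_gt0 n : 0 < inv_succ n.
Proof. by rewrite invr_gt0 ltr0n. Qed.

Lemma inv_succ_le1 n : inv_succ n <= 1.
Proof. by rewrite invf_le1 ?ltr0n// ler1n. Qed.

Lemma cvg_inv_succ : inv_succ @ \oo --> (0 : R).
Proof. exact: cvg_harmonic. Qed.

End Quotients.

Section Bump.
Context {R : realType}.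

(** A cutoff for the unit segment. It is only Lipschitz, but its square has the
    derivative [2 * bump x * dbump x] at every point of the line. *)
Definition bump (x : R) : R := clamp x * (1 - clamp x).
Definition dbump (x : R) : R := 1 - 2 * clamp x.

Lemma bump_ge0 x : 0 <= bump x.
Proof. by rewrite mulr_ge0 ?clamp_ge0// subr_ge0 clamp_le1. Qed.

Lemma bump_le x : bump x <= 4^-1.
Proof.
rewrite /bump -subr_ge0.
have -> : 4^-1 - clamp x * (1 - clamp x) = (clamp x - 2^-1) ^+ 2 by field.
exact: sqr_ge0.
Qed.

Lemma dbump_le x : `|dbump x| <= 1.
Proof.
rewrite /dbump ler_norml; have := clamp_ge0 x; have := clamp_le1 x => h1 h2.
by apply/andP; split; lra.
Qed.

Lemma bump_out x : ~~ (0 < x < 1) -> bump x = 0.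
Proof.
rewrite /bump; case: (clampP x) => -[h ->] hx; rewrite ?mul0r ?subrr ?mulr0//.
case/andP: h => x0 x1; move: hx; rewrite negb_and -!leNgt => /orP[h|h].
  have -> : x = 0 by lra.
  by rewrite mul0r.
have -> : x = 1 by lra.
by rewrite subrr mulr0.
Qed.

Lemma bump_lipschitz x y : `|bump x - bump y| <= `|x - y|.
Proof.
apply: le_trans (clamp_lipschitz x y).
have -> : bump x - bump y = (clamp x - clamp y) * (1 - clamp x - clamp y).
  by rewrite /bump; ring.
rewrite normrM ler_piMr// ler_norml.
have := clamp_ge0 x; have := clamp_le1 x; have := clamp_ge0 y; have := clamp_le1 y.
by move=> h1 h2 h3 h4; apply/andP; split; lra.
Qed.

Lemma continuous_bump : continuous bump.
Proof.
by apply: (@continuous_lipschitz _ _ 1) => x y; rewrite mul1r bump_lipschitz.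
Qed.

Lemma bump_sqr_lipschitz x y : `|bump x ^+ 2 - bump y ^+ 2| <= `|x - y|.
Proof.
rewrite subr_sqr normrM -[leRHS]mulr1 ler_pM ?bump_lipschitz//.
rewrite ger0_norm ?addr_ge0 ?bump_ge0//.
by have := bump_le x; have := bump_le y; lra.
Qed.

Lemma is_derive_bump (x : R) : 0 < x < 1 -> is_derive x 1 (fun x => bump x ^+ 2) (2 * bump x * dbump x).
Proof.
move=> /andP[x0 x1].
have H : is_derive x 1 (fun x => (x * (1 - x)) ^+ 2 : R) (2 * (x * (1 - x)) * (1 - 2 * x)).
  by apply: is_derive_eq; rewrite /GRing.scale /=; ring.
have E : \near x, (x * (1 - x)) ^+ 2 = bump x ^+ 2.
  near=> z; rewrite /bump clamp_id//; apply/andP; split.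
    by apply: ltW; near: z; exact: lt_nbhsr.
  by apply: ltW; near: z; exact: lt_nbhsl.
have -> : 2 * bump x * dbump x = 2 * (x * (1 - x)) * (1 - 2 * x).
  by rewrite /bump /dbump clamp_id ?ltW.
exact: near_eq_is_derive E H.
Unshelve. all: by end_near. Qed.

(** Outside of ]0, 1[ the cutoff vanishes and is 1-Lipschitz, so the quotient of its
    square is at most [1 / n]. *)
Lemma cvg_bump_quotient x :
  (fun n => n.+1%:R * (bump x ^+ 2 - bump (x - inv_succ n) ^+ 2)) @ \oo -->
  2 * bump x * dbump x.
Proof.
have [x01|x01] := boolP (0 < x < 1).
  have := @cvg_difference_quotient _ _ _ _ (fun n => - inv_succ n) (is_derive_bump x01).
  have hn n : - inv_succ n != 0 :> R by rewrite oppr_eq0 gt_eqF// inv_succ_gt0.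
  have hc : (fun n => - inv_succ n) @ \oo --> (0 : R).
    by rewrite -oppr0; apply: cvgN; exact: cvg_inv_succ.
  move=> /(_ hn hc); apply: cvg_trans; apply: near_eq_cvg; near=> n => /=.
  by rewrite invrN /inv_succ invrK mulNr -mulrN opprB.
rewrite bump_out// mulr0 mul0r.
apply: (@squeeze_cvgr _ _ _ _ (fun n => - inv_succ n) (cst 0)).
- near=> n; rewrite expr0n/= sub0r mulrN lerN2 oppr_le0.
  have Lh : bump (x - inv_succ n) <= inv_succ n.
    have := bump_lipschitz x (x - inv_succ n).
    have -> : x - (x - inv_succ n) = inv_succ n :> R by ring.
    by rewrite (bump_out x01) sub0r normrN !ger0_norm ?bump_ge0// ltW// inv_succ_gt0.
  rewrite mulr_ge0 ?sqr_ge0 ?ler0n// andbT.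
  apply: (@le_trans _ _ (n.+1%:R * inv_succ n ^+ 2)).
    by rewrite ler_wpM2l// lerXn2r// nnegrE ?bump_ge0// ltW// inv_succ_gt0.
  by rewrite expr2 mulrA /inv_succ divff ?mul1r// pnatr_eq0.
- by rewrite -oppr0; apply: cvgN; exact: cvg_inv_succ.
- exact: cvg_cst.
Unshelve. all: by end_near. Qed.

End Bump.

Section SmoothFunctions.
Context {R : realType}.
Local Notation leb := (@lebesgue_measure R).
Local Notation plane := (measurableTypeR R * measurableTypeR R)%type.
Implicit Types (u ux uy : R -> R -> R) (K L : R).

(** [u] is continuously differentiable on the unit square, of partial derivatives [ux]
    and [uy], and extended to the plane by clamping. [K] bounds [u] and is the constant
    that enters the estimates below; [L] bounds the derivatives and is only there to
    dominate difference quotients. *)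
Record square_C1 u ux uy K L : Prop := SquareC1 {
  sq_clamp : forall x y, u (clamp x) (clamp y) = u x y ;
  sq_contx : forall y, continuous (u^~ y) ;
  sq_conty : forall x, continuous (u x) ;
  sq_dx_contx : forall y, continuous (ux^~ y) ;
  sq_dx_conty : forall x, continuous (ux x) ;
  sq_dy_contx : forall y, continuous (uy^~ y) ;
  sq_dy_conty : forall x, continuous (uy x) ;
  sq_dx : forall x y : R, 0 < x < 1 -> is_derive x 1 (u^~ y) (ux x y) ;
  sq_dy : forall x y : R, 0 < y < 1 -> is_derive y 1 (u x) (uy x y) ;
  sq_dxy : forall x y : R, 0 < x < 1 -> 0 < y < 1 ->
    is_derive (0 : R) 1 (fun t => u (x + t) (y + t)) (ux x y + uy x y) ;
  sq_bound : forall x y, `|u x y| <= K ;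
  sq_dx_bound : forall x y, `|ux x y| <= L ;
  sq_dy_bound : forall x y, `|uy x y| <= L
}.

Lemma measurable_plane u : (forall y, continuous (u^~ y)) ->
  (forall x, continuous (u x)) -> measurable_fun setT (fun z : plane => u z.1 z.2).
Proof.
move=> c1 c2; apply: measurable_separately_continuous => // y.
exact: continuous_measurable_fun.
Qed.

Lemma measurable_plane_shift u (h k : R) : (forall y, continuous (u^~ y)) ->
  (forall x, continuous (u x)) ->
  measurable_fun setT (fun z : plane => u (z.1 + h) (z.2 + k)).
Proof.
move=> c1 c2.
apply: (measurableT_comp (measurable_plane c1 c2) (measurable_translate (h, k))).
Qed.

Section OneFunction.
Variables (u ux uy : R -> R -> R) (K L : R).
Hypothesis hu : square_C1 u ux uy K L.

Lemma sq_lipx x x' y : `|u x y - u x' y| <= L * `|x - x'|.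
Proof.
apply: (@clamped_lipschitz _ (u^~ y) (ux^~ y)) => [z|||].
- by rewrite -(sq_clamp hu) clampK (sq_clamp hu).
- exact: sq_contx hu y.
- by move=> z; exact: (sq_dx hu).
- by move=> z; exact: (sq_dx_bound hu).
Qed.

Lemma sq_lipy x y y' : `|u x y - u x y'| <= L * `|y - y'|.
Proof.
apply: (@clamped_lipschitz _ (u x) (uy x)) => [z|||].
- by rewrite -(sq_clamp hu) clampK (sq_clamp hu).
- exact: sq_conty hu x.
- by move=> z; exact: (sq_dy hu).
- by move=> z; exact: (sq_dy_bound hu).
Qed.

Definition quotx n x y := n.+1%:R * (u (x + inv_succ n) y - u x y).
Definition quoty n x y := n.+1%:R * (u x (y + inv_succ n) - u x y).
Definition quotxy n x y := n.+1%:R * (u (x + inv_succ n) (y + inv_succ n) - u x y).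

Lemma quotx_bound n x y : `|quotx n x y| <= L.
Proof.
rewrite normrM ger0_norm ?ler0n//.
apply: le_trans (ler_wpM2l (ler0n _ _) (sq_lipx _ _ _)) _.
rewrite addrAC subrr add0r ger0_norm ?(ltW (inv_succ_gt0 _))//.
by rewrite mulrCA /inv_succ divff ?mulr1// pnatr_eq0.
Qed.

Lemma quoty_bound n x y : `|quoty n x y| <= L.
Proof.
rewrite normrM ger0_norm ?ler0n//.
apply: le_trans (ler_wpM2l (ler0n _ _) (sq_lipy _ _ _)) _.
rewrite addrAC subrr add0r ger0_norm ?(ltW (inv_succ_gt0 _))//.
by rewrite mulrCA /inv_succ divff ?mulr1// pnatr_eq0.
Qed.

Lemma quotxyE n x y : quotxy n x y = quotx n x (y + inv_succ n) + quoty n x y.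
Proof. by rewrite /quotxy /quotx /quoty; ring. Qed.

Lemma quotxy_bound n x y : `|quotxy n x y| <= 2 * L.
Proof.
rewrite quotxyE mulr_natl mulr2n; apply: le_trans (ler_normD _ _) _.
by rewrite lerD ?quotx_bound ?quoty_bound.
Qed.

Let hn n : inv_succ n != 0 :> R.
Proof. by rewrite gt_eqF// inv_succ_gt0. Qed.

Lemma cvg_quotx x y : 0 < x < 1 -> quotx ^~ x ^~ y @ \oo --> ux x y.
Proof.
move=> x01; have := cvg_difference_quotient (sq_dx hu y x01) hn cvg_inv_succ.
apply: cvg_trans; apply: near_eq_cvg; near=> n => /=.
by rewrite /inv_succ invrK.
Unshelve. all: by end_near. Qed.

Lemma cvg_quoty x y : 0 < y < 1 -> quoty ^~ x ^~ y @ \oo --> uy x y.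
Proof.
move=> y01; have := cvg_difference_quotient (sq_dy hu x y01) hn cvg_inv_succ.
apply: cvg_trans; apply: near_eq_cvg; near=> n => /=.
by rewrite /inv_succ invrK.
Unshelve. all: by end_near. Qed.

Lemma cvg_quotxy x y : 0 < x < 1 -> 0 < y < 1 ->
  quotxy ^~ x ^~ y @ \oo --> ux x y + uy x y.
Proof.
move=> x01 y01.
have := cvg_difference_quotient (sq_dxy hu x01 y01) hn cvg_inv_succ.
apply: cvg_trans; apply: near_eq_cvg; near=> n => /=.
by rewrite /inv_succ invrK !add0r !addr0.
Unshelve. all: by end_near. Qed.

Lemma measurable_quotx n : measurable_fun setT (fun z : plane => quotx n z.1 z.2).
Proof.
apply: measurable_funM => //; apply: measurable_funB.
  have := measurable_plane_shift (inv_succ n) 0 (sq_contx hu) (sq_conty hu).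
  by under eq_fun do rewrite addr0.
exact: measurable_plane (sq_contx hu) (sq_conty hu).
Qed.

Lemma measurable_quoty n : measurable_fun setT (fun z : plane => quoty n z.1 z.2).
Proof.
apply: measurable_funM => //; apply: measurable_funB.
  have := measurable_plane_shift 0 (inv_succ n) (sq_contx hu) (sq_conty hu).
  by under eq_fun do rewrite addr0.
exact: measurable_plane (sq_contx hu) (sq_conty hu).
Qed.

Lemma measurable_quotxy n : measurable_fun setT (fun z : plane => quotxy n z.1 z.2).
Proof.
apply: measurable_funM => //; apply: measurable_funB.
  exact: measurable_plane_shift (sq_contx hu) (sq_conty hu).
exact: measurable_plane (sq_contx hu) (sq_conty hu).
Qed.

End OneFunction.

Let box : set plane := `[-1, 2]%classic `*` `[-1, 2]%classic.

Lemma integrable_box (c : R) : (leb \x leb)%E.-integrable setT (fun z : plane => (c * \1_box z)%:E).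
Proof.
have mb : measurable box by apply: measurableX; exact: measurable_itv.
under eq_fun do rewrite EFinM.
apply: integrableZl => //; apply/integrableP; split; first exact/measurable_EFinP.
rewrite (eq_integral (fun x => (\1_box x)%:E)); last first.
  by move=> t _; rewrite gee0_abs// lee_fin.
rewrite integral_indic// setIT => /=.
have -> : ((leb \x leb) box = leb `[(-1)%R, 2%R]%classic * leb `[(-1)%R, 2%R]%classic)%E.
  by apply: product_measure1E; exact: measurable_itv.
rewrite !lebesgue_measure_itv/= lte_fin.
by case: ifP => _; rewrite ?mule0 ?ltry// -EFinB -EFinM ltry.
Qed.


Lemma integrable_bounded_box (f : plane -> R) (c : R) : measurable_fun setT f ->
  (forall z, `|f z| <= c * \1_box z) -> (leb \x leb)%E.-integrable setT (EFin \o f).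
Proof.
move=> mf fc; apply: le_integrable (integrable_box c) => //.
  exact/measurable_EFinP.
move=> z _ /=; rewrite lee_fin; apply: le_trans (fc z) _; exact: ler_norm.
Qed.

(** The box is large enough for the supports of the cutoff and of its translates by
    at most 1. *)
Lemma bump_box (z : plane) n : ~ box z ->
  bump z.1 = 0 /\ bump (z.1 - inv_succ n) = 0 \/
  bump z.2 = 0 /\ bump (z.2 - inv_succ n) = 0.
Proof.
have h0 := @inv_succ_gt0 R n; have h1 := @inv_succ_le1 R n.
have out (x : R) : ~~ (-1 <= x <= 2) -> bump x = 0 /\ bump (x - inv_succ n) = 0.
  rewrite negb_and -!ltNge => /orP[x1|x1].
    split; apply: bump_out; rewrite negb_and -!leNgt; apply/orP; left; lra.
  split; apply: bump_out; rewrite negb_and -!leNgt; apply/orP; right; lra.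
move=> nbz.
have [z1|/out] := boolP (-1 <= z.1 <= 2); last by left.
have [z2|/out] := boolP (-1 <= z.2 <= 2); last by right.
by exfalso; apply: nbz; split => /=; rewrite in_itv.
Qed.

End SmoothFunctions.

Section Jacobian.
Context {R : realType}.
Local Notation leb := (@lebesgue_measure R).
Local Notation leb2 := (leb \x leb)%E.
Local Notation plane := (measurableTypeR R * measurableTypeR R)%type.
Variables (u ux uy v vx vy : R -> R -> R) (K L : R).
Hypothesis hu : square_C1 u ux uy K L.
Hypothesis hv : square_C1 v vx vy K L.

Let q (x : R) := bump x ^+ 2.
Let box : set plane := `[-1, 2]%classic `*` `[-1, 2]%classic.

(* The cross product of the diagonals of the image by (u, v) of the cell of side
   [1 / n] at (x, y), scaled by the area of the cell: its limit is twice the Jacobian. *)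
Let area n x y := quotxy u n x y * (quoty v n x y - quotx v n x y)
  - quotxy v n x y * (quoty u n x y - quotx u n x y).
Let edgex n x y := u x y * quotx v n x y - v x y * quotx u n x y.
Let edgey n x y := u x y * quoty v n x y - v x y * quoty u n x y.
Let dq n x := n.+1%:R * (q x - q (x - inv_succ n)).

(* The weighted area of a cell, corrected by the terms that summation by parts moves
   from the area to the weight. *)
Let cell n (z : plane) := q z.1 * q z.2 * area n z.1 z.2
  - edgex n z.1 z.2 * (q z.1 * dq n z.2) + edgey n z.1 z.2 * (q z.2 * dq n z.1).

Definition jacobian_form (z : plane) : R :=
  q z.1 * q z.2 * (2 * (ux z.1 z.2 * vy z.1 z.2 - uy z.1 z.2 * vx z.1 z.2))
  - (u z.1 z.2 * vx z.1 z.2 - v z.1 z.2 * ux z.1 z.2) * (q z.1 * (2 * bump z.2 * dbump z.2))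
  + (u z.1 z.2 * vy z.1 z.2 - v z.1 z.2 * uy z.1 z.2) * (q z.2 * (2 * bump z.1 * dbump z.1)).

Let K0 : 0 <= K. Proof. exact: le_trans (sq_bound hu 0 0). Qed.
Let L0 : 0 <= L. Proof. exact: le_trans (sq_dx_bound hu 0 0). Qed.

Let edgex_bound n x y : `|edgex n x y| <= 2 * (K * L).
Proof.
rewrite mulr_natl mulr2n.
apply: le_trans (ler_normB _ _) _; rewrite (normrM (u x y)) (normrM (v x y)).
by apply: lerD; apply: ler_pM => //; first [exact: sq_bound hu _ _|exact: sq_bound hv _ _
  |exact: quotx_bound hu _ _ _|exact: quotx_bound hv _ _ _].
Qed.

Let edgey_bound n x y : `|edgey n x y| <= 2 * (K * L).
Proof.
rewrite mulr_natl mulr2n.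
apply: le_trans (ler_normB _ _) _; rewrite (normrM (u x y)) (normrM (v x y)).
by apply: lerD; apply: ler_pM => //; first [exact: sq_bound hu _ _|exact: sq_bound hv _ _
  |exact: quoty_bound hu _ _ _|exact: quoty_bound hv _ _ _].
Qed.

Let area_bound n x y : `|area n x y| <= 8 * L ^+ 2.
Proof.
have -> : 8 * L ^+ 2 = (2 * L) * (L + L) + (2 * L) * (L + L) by ring.
apply: le_trans (ler_normB _ _) _.
rewrite (normrM (quotxy u n x y)) (normrM (quotxy v n x y)).
apply: lerD; apply: ler_pM => //; first [exact: quotxy_bound hu _ _ _|exact: quotxy_bound hv _ _ _
  |apply: le_trans (ler_normB _ _) _].
  by apply: lerD; [exact: quoty_bound hv _ _ _|exact: quotx_bound hv _ _ _].
by apply: lerD; [exact: quoty_bound hu _ _ _|exact: quotx_bound hu _ _ _].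
Qed.

Let q_ge0 x : 0 <= q x. Proof. exact: sqr_ge0. Qed.

Let q_le1 x : q x <= 1.
Proof.
rewrite /q expr_le1 ?bump_ge0//; apply: le_trans (bump_le x) _; lra.
Qed.

Let dq_bound n x : `|dq n x| <= 1.
Proof.
rewrite normrM ger0_norm ?ler0n//.
apply: le_trans (ler_wpM2l (ler0n _ _) (bump_sqr_lipschitz _ _)) _.
have -> : x - (x - inv_succ n) = inv_succ n by ring.
by rewrite ger0_norm ?(ltW (inv_succ_gt0 _))// /inv_succ divff// pnatr_eq0.
Qed.

Let cell_bound n z : `|cell n z| <= (8 * L ^+ 2 + 4 * (K * L)) * \1_box z.
Proof.
have [bz|nbz] := pselect (box z); last first.
  have -> : cell n z = 0.
    rewrite /cell /dq /q; case: (bump_box n nbz) => -[-> ->];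
    by rewrite !expr0n /= ?subrr ?(mul0r, mulr0, subr0, addr0, sub0r, oppr0).
  by rewrite normr0 mulr_ge0// addr_ge0 ?mulr_ge0 ?sqr_ge0.
rewrite indicE mem_set// mulr1 /cell.
have -> : 8 * L ^+ 2 + 4 * (K * L) =
  1 * 1 * (8 * L ^+ 2) + 2 * (K * L) * (1 * 1) + 2 * (K * L) * (1 * 1) by ring.
case: z {bz} => x y /=; have qn t : `|q t| <= 1 by rewrite ger0_norm.
have qdq s t : `|q s * dq n t| <= 1 * 1 by rewrite (normrM (q s)) ler_pM.
apply: le_trans (ler_normD _ _) _; apply: lerD; last first.
  by rewrite (normrM (edgey n x y)) ler_pM.
apply: le_trans (ler_normB _ _) _; apply: lerD; last first.
  by rewrite (normrM (edgex n x y)) ler_pM.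
by rewrite (normrM (q x * q y)) ler_pM// (normrM (q x)) ler_pM.
Qed.

Let cvg_cell z : cell ^~ z @ \oo --> jacobian_form z.
Proof.
case: z => x y.
have cvgdq t : dq ^~ t @ \oo --> 2 * bump t * dbump t by exact: cvg_bump_quotient.
have [x01|x01] := boolP (0 < x < 1); last first.
  have b0 := bump_out x01; have q0 : q x = 0 by rewrite /q b0 expr0n.
  have -> : jacobian_form (x, y) = 0 * q y by rewrite /jacobian_form /= q0 b0; ring.
  have -> : cell ^~ (x, y) = fun n => edgey n x y * dq n x * q y.
    by apply/funext => n; rewrite /cell /= q0; ring.
  apply: cvgMl; apply: (@cvg_bounded0 _ _ _ (2 * (K * L))) => //.
  by have := cvgdq x; rewrite b0 mulr0 mul0r.
have [y01|y01] := boolP (0 < y < 1); last first.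
  have b0 := bump_out y01; have q0 : q y = 0 by rewrite /q b0 expr0n.
  have -> : jacobian_form (x, y) = 0 * - q x by rewrite /jacobian_form /= q0 b0; ring.
  have -> : cell ^~ (x, y) = fun n => edgex n x y * dq n y * - q x.
    by apply/funext => n; rewrite /cell /= q0; ring.
  apply: cvgMl; apply: (@cvg_bounded0 _ _ _ (2 * (K * L))) => //.
  by have := cvgdq y; rewrite b0 mulr0 mul0r.
rewrite /cell /jacobian_form /=.
have -> : 2 * (ux x y * vy x y - uy x y * vx x y) =
  (ux x y + uy x y) * (vy x y - vx x y) - (vx x y + vy x y) * (uy x y - ux x y) by ring.
have cux := @cvg_quotx _ _ _ _ _ _ hu x y x01; have cuy := @cvg_quoty _ _ _ _ _ _ hu x y y01.
have cvx := @cvg_quotx _ _ _ _ _ _ hv x y x01; have cvy := @cvg_quoty _ _ _ _ _ _ hv x y y01.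
have cu := cvg_quotxy hu x01 y01; have cv := cvg_quotxy hv x01 y01.
apply: cvgD; [apply: cvgB|].
- apply: cvgMr; apply: cvgB; apply: cvgM => //; exact: cvgB.
- apply: cvgM; first by apply: cvgB; apply: cvgMr.
  by apply: cvgMr.
- apply: cvgM; first by apply: cvgB; apply: cvgMr.
  by apply: cvgMr.
Qed.


Let mcomp (f : R -> R) : continuous f ->
  measurable_fun setT (fun z : plane => f z.1) /\ measurable_fun setT (fun z : plane => f z.2).
Proof.
by move=> /continuous_measurable_fun mf; split; exact: measurableT_comp.
Qed.

Let cq : continuous q.
Proof. by move=> x; rewrite /q; apply: cvgM; exact: continuous_bump. Qed.

Let cdq n : continuous (dq n).
Proof.
move=> x; rewrite /dq; apply: cvgMr; apply: cvgB; first exact: cq.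
apply: (@continuous_comp _ _ _ (fun x => x - inv_succ n) q); last exact: cq.
by apply: cvgB; [exact: cvg_id|exact: cvg_cst].
Qed.

Let mu := measurable_plane (sq_contx hu) (sq_conty hu).
Let mv := measurable_plane (sq_contx hv) (sq_conty hv).

Let measurable_edgex n : measurable_fun setT (fun z : plane => edgex n z.1 z.2).
Proof.
by apply: measurable_funB; apply: measurable_funM => //;
  first [exact: measurable_quotx hu n|exact: measurable_quotx hv n].
Qed.

Let measurable_edgey n : measurable_fun setT (fun z : plane => edgey n z.1 z.2).
Proof.
by apply: measurable_funB; apply: measurable_funM => //;
  first [exact: measurable_quoty hu n|exact: measurable_quoty hv n].
Qed.

Let measurable_area n : measurable_fun setT (fun z : plane => area n z.1 z.2).
Proof.
apply: measurable_funB; apply: measurable_funM;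
  try first [exact: measurable_quotxy hu n|exact: measurable_quotxy hv n];
by apply: measurable_funB; [first [exact: measurable_quoty hu n|exact: measurable_quoty hv n]
  |first [exact: measurable_quotx hu n|exact: measurable_quotx hv n]].
Qed.

Let measurable_cell n : measurable_fun setT (cell n).
Proof.
have [mq1 mq2] := mcomp cq; have [md1 md2] := mcomp (cdq (n := n)).
apply: measurable_funD; [apply: measurable_funB|];
  by apply: measurable_funM => //; exact: measurable_funM.
Qed.

Let G1 n (z : plane) := q z.1 * q (z.2 - inv_succ n) *
  (u z.1 z.2 * v (z.1 + inv_succ n) z.2 - v z.1 z.2 * u (z.1 + inv_succ n) z.2).
Let G2 n (z : plane) := q (z.1 - inv_succ n) * q z.2 *
  (u z.1 z.2 * v z.1 (z.2 + inv_succ n) - v z.1 z.2 * u z.1 (z.2 + inv_succ n)).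

(* The area of a quadrilateral is the sum of one term for each of its edges, and opposite
   edges are translates of each other. *)
Let cellE n z : cell n z = n.+1%:R ^+ 2 *
  ((G1 n z - G1 n (translate (0, inv_succ n) z)) -
   (G2 n z - G2 n (translate (inv_succ n, 0) z))).
Proof.
rewrite /cell /area /edgex /edgey /dq /quotx /quoty /quotxy /G1 /G2 /translate /=.
by rewrite /shift !addr0 !addrK; ring.
Qed.

Let cross_bound z (A : R) (a b c d : R) : `|A| <= 1 -> (~ box z -> A = 0) ->
  `|a| <= K -> `|b| <= K -> `|c| <= K -> `|d| <= K ->
  `|A * (a * b - c * d)| <= (2 * K ^+ 2) * \1_box z.
Proof.
move=> A1 Abox aK bK cK dK; have [bz|/Abox ->] := pselect (box z); last first.
  by rewrite mul0r normr0 mulr_ge0// mulr_ge0 ?sqr_ge0.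
rewrite indicE mem_set// mulr1 normrM -[leRHS]mul1r ler_pM//.
apply: le_trans (ler_normB _ _) _; rewrite !normrM mulr_natl mulr2n expr2.
by apply: lerD; exact: ler_pM.
Qed.

Let qq s t : `|q s * q t| <= 1.
Proof. by rewrite ger0_norm; [exact: mulr_ile1|exact: mulr_ge0]. Qed.

Let mshift (f : R -> R) h : continuous f ->
  measurable_fun setT (fun z : plane => f (z.1 - h)) /\
  measurable_fun setT (fun z : plane => f (z.2 - h)).
Proof.
move=> cf; apply: (@mcomp (fun x => f (x - h))) => x.
apply: (@continuous_comp _ _ _ (fun x => x - h) f); last exact: cf.
by apply: cvgB; [exact: cvg_id|exact: cvg_cst].
Qed.

Let measurable_G1 n : measurable_fun setT (G1 n).
Proof.
have [mq1 _] := mcomp cq; have [_ mq2] := mshift (inv_succ n) cq.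
have mus := measurable_plane_shift (inv_succ n) 0 (sq_contx hu) (sq_conty hu).
have mvs := measurable_plane_shift (inv_succ n) 0 (sq_contx hv) (sq_conty hv).
have E (f : R -> R -> R) : (fun z : plane => f (z.1 + inv_succ n) (z.2 + 0)) =
  (fun z : plane => f (z.1 + inv_succ n) z.2) by apply/funext => z; rewrite addr0.
rewrite !E in mus mvs.
by apply: measurable_funM; [exact: measurable_funM|apply: measurable_funB; exact: measurable_funM].
Qed.

Let measurable_G2 n : measurable_fun setT (G2 n).
Proof.
have [_ mq1] := mcomp cq; have [mq2 _] := mshift (inv_succ n) cq.
have mus := measurable_plane_shift 0 (inv_succ n) (sq_contx hu) (sq_conty hu).
have mvs := measurable_plane_shift 0 (inv_succ n) (sq_contx hv) (sq_conty hv).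
have E (f : R -> R -> R) : (fun z : plane => f (z.1 + 0) (z.2 + inv_succ n)) =
  (fun z : plane => f z.1 (z.2 + inv_succ n)) by apply/funext => z; rewrite addr0.
rewrite !E in mus mvs.
by apply: measurable_funM; [exact: measurable_funM|apply: measurable_funB; exact: measurable_funM].
Qed.

Let zero_out n (z : plane) : ~ box z ->
  [/\ q z.1 * q (z.2 - inv_succ n) = 0, q (z.1 - inv_succ n) * q z.2 = 0 & q z.1 * q z.2 = 0].
Proof.
by move=> /(bump_box n); rewrite /q => -[] [-> ->]; rewrite !expr0n /= ?(mul0r, mulr0).
Qed.

Let integrable_G1 n : leb2.-integrable setT (EFin \o G1 n).
Proof.
apply: (integrable_bounded_box (c := 2 * K ^+ 2)); first exact: measurable_G1.
move=> z; apply: cross_bound; rewrite ?qq//; try by [exact: sq_bound hu _ _|exact: sq_bound hv _ _].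
by case/(zero_out n).
Qed.

Let integrable_G2 n : leb2.-integrable setT (EFin \o G2 n).
Proof.
apply: (integrable_bounded_box (c := 2 * K ^+ 2)); first exact: measurable_G2.
move=> z; apply: cross_bound; rewrite ?qq//; try by [exact: sq_bound hu _ _|exact: sq_bound hv _ _].
by case/(zero_out n).
Qed.

Let integrable_G1_shift n :
  leb2.-integrable setT (EFin \o (G1 n \o translate (0, inv_succ n))).
Proof.
apply: (integrable_bounded_box (c := 2 * K ^+ 2)).
  by apply: measurableT_comp; [exact: measurable_G1|exact: measurable_translate].
move=> z; apply: cross_bound; rewrite ?qq//; try by [exact: sq_bound hu _ _|exact: sq_bound hv _ _].
by case/(zero_out n) => _ _; rewrite /= /shift addr0 addrK.
Qed.

Let integrable_G2_shift n :
  leb2.-integrable setT (EFin \o (G2 n \o translate (inv_succ n, 0))).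
Proof.
apply: (integrable_bounded_box (c := 2 * K ^+ 2)).
  by apply: measurableT_comp; [exact: measurable_G2|exact: measurable_translate].
move=> z; apply: cross_bound; rewrite ?qq//; try by [exact: sq_bound hu _ _|exact: sq_bound hv _ _].
by case/(zero_out n) => _ _; rewrite /= /shift addr0 addrK.
Qed.

Let integral_cell n : (\int[leb2]_z cell n z)%R = 0.
Proof.
have i1 := integrableB measurableT (@integrable_G1 n) (@integrable_G1_shift n).
have i2 := integrableB measurableT (@integrable_G2 n) (@integrable_G2_shift n).
under eq_Rintegral do rewrite cellE.
rewrite RintegralZl//; last exact: (integrableB measurableT i1 i2).
rewrite RintegralB// (RintegralB measurableT (@integrable_G1 n) (@integrable_G1_shift n)).
rewrite (RintegralB measurableT (@integrable_G2 n) (@integrable_G2_shift n)).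
rewrite (integral_translate (@measurable_G1 n) (@integrable_G1_shift n)).
rewrite (integral_translate (@measurable_G2 n) (@integrable_G2_shift n)).
by rewrite !subrr mulr0.
Qed.

(** The Jacobian determinant is a null Lagrangian: against a weight, it integrates to
    terms of first order in the derivatives. For maps that are only C^1 this is obtained
    from the areas of the images of small cells: by [cellE] they are differences between
    functions and their translates, so they integrate to 0, and difference quotients are
    dominated because [u] and [v] are Lipschitz. *)
Lemma integral_jacobian_form : leb2.-integrable setT (EFin \o jacobian_form) /\
  (\int[leb2]_z jacobian_form z)%R = 0.
Proof.
have mj : measurable_fun setT jacobian_form.
  apply: (@measurable_fun_cvg _ plane R setT cell) => [n|z _].
    exact: measurable_cell.
  exact: cvg_cell.
have [] := @dominated_convergence _ _ _ leb2 setT measurableT (fun n => EFin \o cell n)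
  (EFin \o jacobian_form) (fun z => ((8 * L ^+ 2 + 4 * (K * L)) * \1_box z)%:E).
- by move=> n; apply/measurable_EFinP; exact: measurable_cell.
- exact/measurable_EFinP.
- by apply: aeW => z _; apply: cvg_EFin; [exact: nearW|exact: cvg_cell].
- exact: integrable_box.
- by apply: aeW => z n _ /=; rewrite lee_fin; exact: cell_bound.
move=> ij _ cint; split => //; rewrite /Rintegral.
have ci n : leb2.-integrable setT (EFin \o cell n).
  exact: integrable_bounded_box (measurable_cell n) (cell_bound n).
have E : (fun n => \int[leb2]_z (EFin \o cell n) z)%E = cst 0%E.
  apply/funext => n; rewrite -[LHS]fineK; last exact: integrable_fin_num (ci n).
  by congr EFin; exact: integral_cell.
rewrite [X in X @ _](_ : _ = cst 0%E) in cint; last by rewrite -E.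
by rewrite -(cvg_lim (@ereal_hausdorff R) cint) lim_cst//; exact: ereal_hausdorff.
Qed.

End Jacobian.

(** * Monotone maps of the plane have bounded variation *)

Lemma integral_derive (R : realType) (f df : R -> R) (a b : R) : a < b ->
  continuous f -> continuous df -> (forall x : R, a < x < b -> is_derive x 1 f (df x)) ->
  (\int[lebesgue_measure]_(x in `[a, b]) (df x)%:E = (f b - f a)%:E)%E.
Proof.
move=> ab cf cdf dff; rewrite (@continuous_FTC2 _ df f)//.
- exact: continuous_subspaceT.
- split.
  + by move=> x; rewrite in_itv/= => /dff h; exact: ex_derive.
  + exact/cvg_at_right_filter/cf.
  + exact/cvg_at_left_filter/cf.
- by move=> x; rewrite in_itv/= => /dff h; rewrite derive1E; exact: derive_val.
Qed.

(** For a Jacobian whose symmetric part is negative, the determinant dominates a quarter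
    of [(B - C) ^+ 2], and the symmetric part is dominated by its trace. So the terms of
    first order in [B - C] can be absorbed by the determinant, and [B] is bounded by the
    integrand of [integral_jacobian_form] up to multiples of the trace and of [K ^+ 2]. *)
Lemma antisymmetric_part_le (R : realType) (A B C D U V a b da db K : R) : 0 < K ->
  (forall s t, A * s ^+ 2 + (B + C) * s * t + D * t ^+ 2 <= 0) ->
  `|U| <= K -> `|V| <= K -> 0 <= a <= 4^-1 -> 0 <= b <= 4^-1 -> `|da| <= 1 -> `|db| <= 1 ->
  K * (a * b * `|B|) <=
    (a ^+ 2 * b ^+ 2 * (2 * (A * D - B * C)) - (U * C - V * A) * (a ^+ 2 * (2 * b * db))
    + (U * D - V * B) * (b ^+ 2 * (2 * a * da))) + (2 * K * - (A + D) + K ^+ 2 / 2).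
Proof.
move=> K0 neg UK VK /andP[a0 a1] /andP[b0 b1] da1 db1.
have A0 : A <= 0 by have := neg 1 0; rewrite expr1n expr0n /=; lra.
have D0 : D <= 0 by have := neg 0 1; rewrite expr1n expr0n /=; lra.
set s := - (A + D); set e := a * b; set beta := `|B - C|.
have e0 : 0 <= e by exact: mulr_ge0.
have e1 : e <= 4^-1 by rewrite /e; nra.
have s0 : 0 <= s by rewrite /s; lra.
have sg1 : `|B + C| <= s.
  rewrite ler_norml; have := neg 1 1; have := neg 1 (-1).
  rewrite sqrrN expr1n /s => h1 h2; apply/andP; split; lra.
have bet2 : beta ^+ 2 = (B - C) ^+ 2 by rewrite /beta real_normK// num_real.
have beta0 : 0 <= beta by exact: normr_ge0.
have det : beta ^+ 2 / 2 <= 2 * (A * D - B * C).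
  rewrite bet2.
  suff : (B + C) ^+ 2 <= 4 * (A * D).
    have -> : 2 * (A * D - B * C) = (4 * (A * D) - (B + C) ^+ 2 + (B - C) ^+ 2) / 2 by field.
    lra.
  (* the discriminant of a nonpositive quadratic form; [A = 0] forces [B + C = 0] *)
  have [A00|An0] := eqVneq A 0.
    have [->|BC0] := eqVneq (B + C) 0; first by rewrite A00 mul0r mulr0 expr0n.
    have := neg ((1 - D) / (B + C)) 1; rewrite A00 mul0r add0r [(B + C) * _]mulrC divfK//.
    by rewrite expr1n; lra.
  have {An0}A0 : A < 0 by rewrite lt_neqAle An0.
  rewrite -subr_ge0 -(nmulr_rle0 _ A0).
  apply: le_trans (neg (B + C) (- 2 * A)); rewrite le_eqVlt; apply/orP; left; apply/eqP; ring.
have Bn : `|B| <= (s + beta) / 2.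
  have -> : B = ((B + C) + (B - C)) / 2 by field.
  rewrite normrM [X in _ * X]ger0_norm ?invr_ge0// ler_pM2r ?invr_gt0//.
  by apply: le_trans (ler_normD _ _) _; rewrite lerD2r.
have Cn : `|C| <= (s + beta) / 2.
  have -> : C = ((B + C) - (B - C)) / 2 by field.
  rewrite normrM [X in _ * X]ger0_norm ?invr_ge0// ler_pM2r ?invr_gt0//.
  by apply: le_trans (ler_normB _ _) _; rewrite lerD2r.
have An : `|A| <= s by rewrite ler0_norm// /s; lra.
have Dn : `|D| <= s by rewrite ler0_norm// /s; lra.
have T (X Y c f dc : R) : `|X| <= s -> `|Y| <= (s + beta) / 2 -> c * f = e ->
    0 <= c <= 4^-1 -> 0 <= f -> `|dc| <= 1 ->
    forall U V : R, `|U| <= K -> `|V| <= K ->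
    `|(U * X - V * Y) * (c ^+ 2 * (2 * f * dc))| <= K * e * (3 * s + beta) / 4.
  move=> Xs Ys cf /andP[c0 c1] f0 dc1 U' V' U'K V'K.
  have -> : c ^+ 2 * (2 * f * dc) = 2 * c * e * dc by rewrite -cf; ring.
  rewrite normrM.
  have -> : K * e * (3 * s + beta) / 4 = (K * s + K * ((s + beta) / 2)) * (2^-1 * e * 1) by field.
  apply: ler_pM => //.
    apply: le_trans (ler_normB _ _) _; rewrite !normrM.
    by apply: lerD; exact: ler_pM.
  rewrite normrM; apply: ler_pM => //.
  rewrite ger0_norm ?mulr_ge0//; apply: ler_wpM2r => //; lra.
have T1 := T A C a b db An Cn erefl (introT andP (conj a0 a1)) b0 db1 V U VK UK.
have T2 := T D B b a da Dn Bn (mulrC _ _) (introT andP (conj b0 b1)) a0 da1 U V UK VK.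
have Hdet : e ^+ 2 * (beta ^+ 2 / 2) <= a ^+ 2 * b ^+ 2 * (2 * (A * D - B * C)).
  by rewrite /e exprMn ler_wpM2l// mulr_ge0 ?sqr_ge0.
have {}T1 : (U * C - V * A) * (a ^+ 2 * (2 * b * db)) <= K * e * (3 * s + beta) / 4.
  apply: le_trans T1; apply: le_trans (ler_norm _) _.
  by rewrite !normrM -(distrC (U * C)) lexx.
have {}T2 : - (K * e * (3 * s + beta) / 4) <= (U * D - V * B) * (b ^+ 2 * (2 * a * da)).
  by move: T2; rewrite ler_norml => /andP[].
have Hb : K * (e * `|B|) <= K * e * ((s + beta) / 2).
  by rewrite -mulrA ler_wpM2l ?(ltW K0)// ler_wpM2l.
have Hq : K * (e * beta) <= (e * beta) ^+ 2 / 2 + K ^+ 2 / 2.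
  by have := sqr_ge0 (e * beta - K); rewrite sqrrB; lra.
have Hs : K * e * s <= K * s * 4^-1.
  by rewrite -mulrA [e * s]mulrC mulrA ler_wpM2l// mulr_ge0// ltW.
have Ks : 0 <= K * s by rewrite mulr_ge0// ltW.
move: Hq Hdet; rewrite exprMn; lra.
Qed.

Section RotationBound.
Context {R : realType}.
Local Notation leb := (@lebesgue_measure R).
Local Notation leb2 := (leb \x leb)%E.
Local Notation plane := (measurableTypeR R * measurableTypeR R)%type.
Variables (u ux uy v vx vy : R -> R -> R) (K L : R).
Hypothesis hu : square_C1 u ux uy K L.
Hypothesis hv : square_C1 v vx vy K L.
Hypothesis K_gt0 : 0 < K.
Hypothesis neg : forall x y s t : R,
  ux x y * s ^+ 2 + (uy x y + vx x y) * s * t + vy x y * t ^+ 2 <= 0.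

Let I : set R := `[0, 1]%classic.
Let Q (z : plane) : R := \1_I z.1 * \1_I z.2.

Let ux_le0 x y : ux x y <= 0.
Proof. by have := neg x y 1 0; rewrite expr1n expr0n /=; lra. Qed.

Let vy_le0 x y : vy x y <= 0.
Proof. by have := neg x y 0 1; rewrite expr1n expr0n /=; lra. Qed.

Let integral_segment (f df : R -> R) : continuous f -> continuous df ->
  (forall x : R, 0 < x < 1 -> is_derive x 1 f (df x)) ->
  (forall x, `|f x| <= K) ->
  (\int[leb]_x (- df x * \1_I x)%:E <= (2 * K)%:E)%E.
Proof.
move=> cf cdf dff fK.
rewrite (_ : (fun x => _) = (EFin \o (- df)) \_ I); last first.
  apply/funext => x; rewrite patchE indicE /=; case: ifP => _ /=.
    by rewrite mulr1.
  by rewrite mulr0.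
have cNf : continuous (- f) by move=> x; apply: cvgN; exact: cf.
have cNdf : continuous (- df) by move=> x; apply: cvgN; exact: cdf.
have dNf (x : R) : 0 < x < 1 -> is_derive x 1 (- f) ((- df) x).
  by move=> /dff ?; exact: is_deriveN.
rewrite -integral_mkcond /= (integral_derive ltr01 cNf cNdf dNf) lee_fin !fctE.
have := fK 0; have := fK 1; rewrite !ler_norml => /andP[? ?] /andP[? ?]; lra.
Qed.

Let measurable_I : measurable_fun setT (\1_I : measurableTypeR R -> R).
Proof. by apply: measurable_indic; exact: measurable_itv. Qed.

Let measurable_Q : measurable_fun setT Q.
Proof. by apply: measurable_funM; exact: (measurableT_comp measurable_I). Qed.

Let mux := measurable_plane (sq_dx_contx hu) (sq_dx_conty hu).
Let muy := measurable_plane (sq_dy_contx hu) (sq_dy_conty hu).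
Let mvy := measurable_plane (sq_dy_contx hv) (sq_dy_conty hv).

Let Q_ge0 z : 0 <= Q z. Proof. by rewrite mulr_ge0. Qed.

Let integral_indicI (c : R) : (\int[leb]_x (c * \1_I x)%:E = c%:E)%E.
Proof.
rewrite (_ : (fun x => _) = (cst c%:E) \_ I); last first.
  apply/funext => x; rewrite patchE indicE /=; case: ifP => _ /=.
    by rewrite mulr1.
  by rewrite mulr0.
rewrite -integral_mkcond integral_cst; last exact: measurable_itv.
by rewrite /= lebesgue_measure_itv/= lte01 oppr0 adde0 mule1.
Qed.

Let integral_ux : (\int[leb2]_z (- ux z.1 z.2 * Q z)%:E <= (2 * K)%:E)%E.
Proof.
pose F (z : plane) : \bar R := (- ux z.1 z.2 * Q z)%:E.
have mF : measurable_fun setT F.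
  by apply/measurable_EFinP; apply: measurable_funM => //; exact: measurable_funN.
have F0 z : (0 <= F z)%E by rewrite lee_fin mulr_ge0 ?oppr_ge0.
rewrite (fubini_tonelli2 F mF F0) -[leRHS]integral_indicI.
apply: ge0_le_integral => //.
- by move=> t _; apply: integral_ge0 => t' _; exact: F0.
- exact: (measurable_fun_fubini_tonelli_G F mF F0).
- by apply/measurable_EFinP; exact: measurable_funM.
rewrite /F {mF F0 F}.
move=> y _; rewrite /fubini_G /Q /=.
rewrite indicE; case: (y \in I); last first.
  by under eq_integral do rewrite !mulr0; rewrite integral0 mulr0.
under eq_integral do rewrite mulr1.
rewrite mulr1; apply: (@integral_segment (u ^~ y) (ux ^~ y)).
- exact: sq_contx hu y.
- exact: sq_dx_contx hu y.
- by move=> x; exact: sq_dx hu _ _.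
- by move=> x; exact: sq_bound hu _ _.
Qed.

Let integral_vy : (\int[leb2]_z (- vy z.1 z.2 * Q z)%:E <= (2 * K)%:E)%E.
Proof.
pose F (z : plane) : \bar R := (- vy z.1 z.2 * Q z)%:E.
have mF : measurable_fun setT F.
  by apply/measurable_EFinP; apply: measurable_funM => //; exact: measurable_funN.
have F0 z : (0 <= F z)%E by rewrite lee_fin mulr_ge0 ?oppr_ge0.
rewrite (fubini_tonelli1 F mF F0) -[leRHS]integral_indicI.
apply: ge0_le_integral => //.
- by move=> t _; apply: integral_ge0 => t' _; exact: F0.
- exact: (measurable_fun_fubini_tonelli_F F mF F0).
- by apply/measurable_EFinP; exact: measurable_funM.
rewrite /F {mF F0 F}.
move=> x _; rewrite /fubini_F /Q /=.
rewrite indicE; case: (x \in I); last first.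
  by under eq_integral do rewrite mul0r !mulr0; rewrite integral0 mulr0.
under eq_integral do rewrite mul1r.
rewrite mulr1; apply: (@integral_segment (v x) (vy x)).
- exact: sq_conty hv x.
- exact: sq_dy_conty hv x.
- by move=> y; exact: sq_dy hv _ _.
- by move=> y; exact: sq_bound hv _ _.
Qed.

Let Q_le z : Q z <= \1_(`[(-1 : R), 2]%classic `*` `[(-1 : R), 2]%classic) z.
Proof.
rewrite /Q !indicE; case: (boolP (z.1 \in I)) => [/set_mem z1|_]; last first.
  by rewrite mul0r ler0n.
case: (boolP (z.2 \in I)) => [/set_mem z2|_]; last by rewrite mulr0 ler0n.
have inI (t : R) : I t -> (`[(-1 : R), 2]%classic : set R) t.
  rewrite /I /= !in_itv/= => /andP[? ?]; apply/andP; split; lra.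
by rewrite mem_set ?mulr1//; split; exact: inI.
Qed.

Let integrable_Q (f : plane -> R) c : measurable_fun setT f -> (forall z, `|f z| <= c) ->
  leb2.-integrable setT (EFin \o (fun z => f z * Q z)).
Proof.
move=> mf fc; apply: (@integrable_bounded_box _ _ c); first exact: measurable_funM.
move=> z; rewrite normrM ler_pM// ger0_norm//; exact: Q_le.
Qed.

Let L_ge0 : 0 <= L. Proof. exact: le_trans (sq_dx_bound hu 0 0). Qed.

Let fine_bound (f : plane -> R) c : leb2.-integrable setT (EFin \o f) ->
  (\int[leb2]_z (f z)%:E <= c%:E)%E -> (\int[leb2]_z f z)%R <= c.
Proof.
move=> intf fc; rewrite -lee_fin /Rintegral fineK//; exact: integrable_fin_num intf.
Qed.

Let pointwise z : K * (bump z.1 * bump z.2 * `|uy z.1 z.2|) <=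
  jacobian_form u ux uy v vx vy z +
  (2 * K * (- ux z.1 z.2 * Q z) + 2 * K * (- vy z.1 z.2 * Q z) + K ^+ 2 / 2 * (1 * Q z)).
Proof.
case: z => x y /=.
have rhs0 c : 0 <= c -> 0 <= 2 * K * (- ux x y * c) + 2 * K * (- vy x y * c) + K ^+ 2 / 2 * (1 * c).
  have := ux_le0 x y; have := vy_le0 x y => h1 h2 c0.
  by rewrite !addr_ge0 ?mulr_ge0 ?oppr_ge0 ?invr_ge0 ?(ltW K_gt0) ?sqr_ge0.
have [x01|x01] := boolP (0 < x < 1); last first.
  have -> : jacobian_form u ux uy v vx vy (x, y) = 0.
    by rewrite /jacobian_form /= (bump_out x01); ring.
  by rewrite (bump_out x01) !(mul0r, mulr0) add0r; apply: rhs0.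
have [y01|y01] := boolP (0 < y < 1); last first.
  have -> : jacobian_form u ux uy v vx vy (x, y) = 0.
    by rewrite /jacobian_form /= (bump_out y01); ring.
  by rewrite (bump_out y01) !(mul0r, mulr0) add0r; apply: rhs0.
have -> : Q (x, y) = 1.
  by rewrite /Q !indicE !mem_set ?mulr1//= /I /= in_itv/= !ltW//; case/andP: x01; case/andP: y01.
have H (t : R) : 0 <= bump t <= 4^-1 by rewrite bump_ge0 bump_le.
have := antisymmetric_part_le K_gt0 (neg x y) (sq_bound hu x y) (sq_bound hv x y)
  (H x) (H y) (dbump_le x) (dbump_le y).
by rewrite /jacobian_form /= => h; apply: le_trans h _;
  rewrite le_eqVlt; apply/orP; left; apply/eqP; ring.
Qed.

(** A monotone map of the plane has bounded variation: its cross derivative is integrable,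
    with a bound that is linear in the size of the map and ignores its derivatives. The
    trace integrates to at most [4 * K] because both of its terms are derivatives of
    constant sign along a coordinate; [antisymmetric_part_le] does the rest. *)
Lemma weighted_cross_derivative_bound :
  (\int[leb2]_z (bump z.1 * bump z.2 * `|uy z.1 z.2|)%:E <= (9 * K)%:E)%E.
Proof.
have [ij j0] := integral_jacobian_form hu hv.
have mbump : measurable_fun setT (fun z : plane => bump z.1 * bump z.2).
  by apply: measurable_funM; apply: measurableT_comp => //;
    apply: continuous_measurable_fun; exact: continuous_bump.
have ie : leb2.-integrable setT
    (EFin \o (fun z : plane => bump z.1 * bump z.2 * `|uy z.1 z.2|)).
  apply: (@integrable_bounded_box _ _ L).
    by apply: measurable_funM => //; exact: measurableT_comp.
  move=> z; apply: (@le_trans _ _ (L * Q z)); last by rewrite ler_wpM2l// Q_le.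
  rewrite normrM normr_id mulrC ler_pM//; first exact: sq_dy_bound hu _ _.
  have bI (t : R) : 0 <= bump t <= \1_I t.
    rewrite bump_ge0 indicE; case: (boolP (t \in I)) => [_|/negP tI] /=.
      by apply: le_trans (bump_le t) _; lra.
    rewrite bump_out//; apply/negP => /andP[t0 t1]; apply: tI; rewrite inE /I /= in_itv/=.
    by rewrite !ltW.
  have /andP[b10 b11] := bI z.1; have /andP[b20 b21] := bI z.2.
  by rewrite ger0_norm; [exact: ler_pM|exact: mulr_ge0].
have i1 : leb2.-integrable setT (EFin \o (fun z : plane => - ux z.1 z.2 * Q z)).
  apply: (@integrable_Q (fun z => - ux z.1 z.2) L); first exact: measurable_funN.
  by move=> z; rewrite normrN; exact: sq_dx_bound hu _ _.
have i2 : leb2.-integrable setT (EFin \o (fun z : plane => - vy z.1 z.2 * Q z)).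
  apply: (@integrable_Q (fun z => - vy z.1 z.2) L); first exact: measurable_funN.
  by move=> z; rewrite normrN; exact: sq_dy_bound hv _ _.
have i3 : leb2.-integrable setT (EFin \o (fun z : plane => 1 * Q z)).
  by apply: (@integrable_Q (cst 1) 1) => // z; rewrite normr1.
have b1 := fine_bound i1 integral_ux; have b2 := fine_bound i2 integral_vy.
have b3 : (\int[leb2]_z (1 * Q z))%R <= 1.
  apply: fine_bound => //; under eq_integral do rewrite mul1r.
  rewrite (fubini_tonelli1 (fun z : plane => (Q z)%:E)); last 2 first.
  - exact/measurable_EFinP.
  - by move=> z; rewrite lee_fin.
  rewrite -[leRHS]integral_indicI le_eqVlt; apply/orP; left; apply/eqP.
  by apply: eq_integral => x _; rewrite /fubini_F /Q /= integral_indicI mul1r.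
have Zi c (f : plane -> R) : leb2.-integrable setT (EFin \o f) ->
    leb2.-integrable setT (EFin \o (fun z => c * f z)).
  by move=> /(integrableZl measurableT c).
have Di (f g : plane -> R) : leb2.-integrable setT (EFin \o f) ->
    leb2.-integrable setT (EFin \o g) -> leb2.-integrable setT (EFin \o (fun z => f z + g z)).
  by move=> h1 h2; exact: (integrableD measurableT h1 h2).
have z1 := Zi (2 * K) _ i1; have z2 := Zi (2 * K) _ i2; have z3 := Zi (K ^+ 2 / 2) _ i3.
have := le_Rintegral measurableT (Zi K _ ie) (Di _ _ ij (Di _ _ (Di _ _ z1 z2) z3))
  (fun z _ => pointwise z).
rewrite (RintegralD measurableT ij (Di _ _ (Di _ _ z1 z2) z3)) j0 add0r.
rewrite (RintegralD measurableT (Di _ _ z1 z2) z3) (RintegralD measurableT z1 z2).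
rewrite (RintegralZl _ measurableT ie) (RintegralZl _ measurableT i1).
rewrite (RintegralZl _ measurableT i2) (RintegralZl _ measurableT i3) => main.
have K2 : 0 <= K ^+ 2 / 2 by rewrite mulr_ge0 ?sqr_ge0.
have c1 := ler_wpM2l (mulr_ge0 (ler0n _ 2) (ltW K_gt0)) b1.
have c2 := ler_wpM2l (mulr_ge0 (ler0n _ 2) (ltW K_gt0)) b2.
have c3 := ler_wpM2l K2 b3.
suff : (\int[leb2]_z (bump z.1 * bump z.2 * `|uy z.1 z.2|))%R <= 9 * K.
  by rewrite -lee_fin /Rintegral fineK//; exact: integrable_fin_num ie.
rewrite -(ler_pM2l K_gt0); apply: le_trans main _.
have -> : K * (9 * K) = 2 * K * (2 * K) + 2 * K * (2 * K) + K ^+ 2 / 2 * 1 + K ^+ 2 / 2.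
  by field.
lra.
Qed.

End RotationBound.

(** * Means along a segment *)

Section SegmentInvariance.
Context d (T : measurableType d) (R : realType) (P : probability T R).
Local Notation leb := (@lebesgue_measure R).
Variables (m : T -> R) (f df : T -> R -> R) (a b : R).
Hypothesis ab : a < b.
Hypothesis mm : measurable_fun setT m.
Hypothesis cf : forall w, continuous (f w).
Hypothesis cdf : forall w, continuous (df w).
Hypothesis dff : forall w (x : R), a < x < b -> is_derive x 1 (f w) (df w x).
Hypothesis mdf : forall x, measurable_fun setT (df ^~ x).
Hypothesis mf : forall x, measurable_fun setT (f ^~ x).
Hypothesis ia : P.-integrable setT (fun w => (m w * f w a)%:E).
Hypothesis ib : P.-integrable setT (fun w => (m w * f w b)%:E).
Hypothesis centered : forall y, a <= y <= b -> (\int[P]_w (m w * df w y)%:E = 0)%E.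

Let F (z : T * measurableTypeR R) : \bar R :=
  (m z.1 * df z.1 z.2)%:E * (\1_(`[a, b]%classic : set R) z.2)%:E.

Let mF : measurable_fun setT F.
Proof.
apply: emeasurable_funM.
  apply/measurable_EFinP; apply: measurable_funM; first exact: measurableT_comp.
  exact: measurable_separately_continuous.
apply/measurable_EFinP; apply: measurableT_comp => //.
Qed.

Let inner (g : R -> \bar R) :
  (\int[leb]_y (g y * (\1_(`[a, b]%classic : set R) y)%:E) = \int[leb]_(y in `[a, b]) g y)%E.
Proof.
rewrite [RHS]integral_mkcond; apply: eq_integral => y _.
by rewrite patchE indicE; case: ifP => _; rewrite ?mule1 ?mule0.
Qed.

(** This is differentiation under the expectation, in integrated form: by Fubini the
    increment of [m * f] has the mean of the integral of [m * df]. *)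
Lemma segment_invariance :
  (\int[P]_w \int[leb]_(y in `[a, b]) `|m w * df w y|%:E < +oo)%E ->
  (\int[P]_w (m w * f w a)%:E = \int[P]_w (m w * f w b)%:E)%E.
Proof.
move=> fin.
have iF : (P \x leb)%E.-integrable setT F.
  apply/integrable12ltyP => //; apply: le_lt_trans fin.
  rewrite le_eqVlt; apply/orP; left; apply/eqP; apply: eq_integral => w _.
  rewrite -inner; apply: eq_integral => y _.
  by rewrite abseM [X in (_ * X)%E]gee0_abs// lee_fin.
have := Fubini iF.
rewrite [RHS](_ : _ = 0%E); last first.
  apply: integral0_eq => y _; rewrite /F /=.
  have [yab|yab] := boolP (a <= y <= b); last first.
    rewrite indicE memNset /= ?in_itv/=; last exact/negP.
    by apply: integral0_eq => w _; rewrite mule0.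
  rewrite indicE mem_set /= ?in_itv//=.
  by under eq_integral do rewrite mule1; exact: centered.
have E w : (\int[leb]_y F (w, y) = (m w * f w b)%:E - (m w * f w a)%:E)%E.
  rewrite /F /= inner.
  have c1 : continuous (fun y => m w * f w y) by move=> y; apply: cvgMr; exact: cf.
  have c2 : continuous (fun y => m w * df w y) by move=> y; apply: cvgMr; exact: cdf.
  have d1 (y : R) : a < y < b -> is_derive y 1 (fun y => m w * f w y) (m w * df w y).
    by move=> /(dff w) ?; exact: is_deriveZ.
  exact: (integral_derive ab c1 c2 d1).
under eq_integral do rewrite E.
rewrite integralB//.
rewrite -(fineK (integrable_fin_num measurableT ia)) -(fineK (integrable_fin_num measurableT ib)).
by rewrite -EFinB => -[] /eqP; rewrite subr_eq0 => /eqP ->.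
Qed.

(** For a monotone [f] the integral of [`|m * df|] is an increment of [f], so that Fubini
    applies without a further hypothesis. *)
Lemma segment_invariance_monotone : (forall w y, df w y <= 0) ->
  (\int[P]_w (m w * f w a)%:E = \int[P]_w (m w * f w b)%:E)%E.
Proof.
move=> df0; apply: segment_invariance.
have E w : (\int[leb]_(y in `[a, b]) `|m w * df w y|%:E = (`|m w| * f w a - `|m w| * f w b)%:E)%E.
  under eq_integral do rewrite normrM (ler0_norm (df0 w _)).
  have c1 : continuous (fun y => - `|m w| * f w y) by move=> y; apply: cvgMr; exact: cf.
  have c2 : continuous (fun y => - `|m w| * df w y) by move=> y; apply: cvgMr; exact: cdf.
  have d1 (y : R) : a < y < b -> is_derive y 1 (fun y => - `|m w| * f w y) (- `|m w| * df w y).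
    by move=> /(dff w) ?; exact: is_deriveZ.
  under eq_integral do rewrite mulrN -mulNr.
  by rewrite (integral_derive ab c1 c2 d1); congr EFin; ring.
under eq_integral do rewrite E.
have N x : P.-integrable setT (fun w => (m w * f w x)%:E) ->
    P.-integrable setT (fun w => (`|m w| * f w x)%:E).
  move=> ix; apply: (le_integrable measurableT _ _ ix).
    by apply/measurable_EFinP; apply: measurable_funM => //; exact: measurableT_comp.
  by move=> w _ /=; rewrite lee_fin !normrM normr_id.
apply: integrable_lty => //; exact: (integrableB measurableT (N _ ia) (N _ ib)).
Qed.

End SegmentInvariance.

Section CrossInvariance.
Context d (T : measurableType d) (R : realType) (P : probability T R).
Local Notation leb := (@lebesgue_measure R).
Local Notation leb2 := (leb \x leb)%E.
Local Notation plane := (measurableTypeR R * measurableTypeR R)%type.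
Variables (m : T -> R) (u ux uy v vx vy : T -> R -> R -> R) (K L : T -> R).
Hypothesis hu : forall w, square_C1 (u w) (ux w) (uy w) (K w) (L w).
Hypothesis hv : forall w, square_C1 (v w) (vx w) (vy w) (K w) (L w).
Hypothesis K_gt0 : forall w, 0 < K w.
Hypothesis neg : forall w x y s t,
  ux w x y * s ^+ 2 + (uy w x y + vx w x y) * s * t + vy w x y * t ^+ 2 <= 0.
Hypothesis mm : measurable_fun setT m.
Hypothesis mu : forall x y, measurable_fun setT (fun w => u w x y).
Hypothesis mux : forall x y, measurable_fun setT (fun w => ux w x y).
Hypothesis muy : forall x y, measurable_fun setT (fun w => uy w x y).
Hypothesis iK : P.-integrable setT (fun w => (m w * K w)%:E).
Hypothesis ux_centered : forall x y, (\int[P]_w (m w * ux w x y)%:E = 0)%E.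
Hypothesis uy_centered : forall x y, (\int[P]_w (m w * uy w x y)%:E = 0)%E.

Let iu x y : P.-integrable setT (fun w => (m w * u w x y)%:E).
Proof.
apply: (le_integrable measurableT _ _ iK).
  by apply/measurable_EFinP; exact: measurable_funM.
move=> w _ /=; rewrite lee_fin !normrM ler_wpM2l// (le_trans (sq_bound (hu w) x y))//.
exact: ler_norm.
Qed.

Let ux_le0 w x y : ux w x y <= 0.
Proof. by have := neg w x y 1 0; rewrite expr1n expr0n /=; lra. Qed.

Let invariance_x x x' y : 0 <= x -> x < x' -> x' <= 1 ->
  (\int[P]_w (m w * u w x y)%:E = \int[P]_w (m w * u w x' y)%:E)%E.
Proof.
move=> x0 xx' x1.
apply: (@segment_invariance_monotone _ _ _ _ _ (fun w x => u w x y) (fun w x => ux w x y)) => //.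
- by move=> w; exact: sq_contx (hu w) y.
- by move=> w; exact: sq_dx_contx (hu w) y.
- move=> w t /andP[xt tx]; apply: (sq_dx (hu w)).
  by rewrite (le_lt_trans x0 xt) (lt_le_trans tx x1).
Qed.

Let TR := (T * measurableTypeR R)%type.

Let weight (z : TR * measurableTypeR R) : \bar R :=
  (`|m z.1.1| * (bump z.1.2 * bump z.2 * `|uy z.1.1 z.1.2 z.2|))%:E.

Let weight_ge0 z : (0 <= weight z)%E.
Proof.
rewrite lee_fin; apply: mulr_ge0 => //; apply: mulr_ge0 => //.
by apply: mulr_ge0; exact: bump_ge0.
Qed.

Let mbump : measurable_fun setT (@bump R : measurableTypeR R -> R).
Proof. exact: continuous_measurable_fun (@continuous_bump R). Qed.

Let measurable_weight : measurable_fun setT weight.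
Proof.
have m1 : measurable_fun setT (fun z : TR * measurableTypeR R => uy z.1.1 z.1.2 z.2).
  apply: (@measurable_separately_continuous _ TR R (fun z y => uy z.1 z.2 y)) => [y|z].
    apply: (@measurable_separately_continuous _ _ R (fun w x => uy w x y)) => [x|w].
      exact: muy.
    exact: sq_dy_contx (hu w) y.
  exact: sq_dy_conty (hu z.1) z.2.
apply/measurable_EFinP; apply: measurable_funM.
  by apply: measurableT_comp => //; apply: (measurableT_comp mm); exact: measurableT_comp.
apply: measurable_funM; last exact: measurableT_comp.
apply: measurable_funM; apply: (measurableT_comp mbump) => //.
exact: measurableT_comp.
Qed.

Let line := fubini_F leb weight.

Let line_ge0 z : (0 <= line z)%E.
Proof. by apply: integral_ge0 => y _; exact: weight_ge0. Qed.

Let measurable_line : measurable_fun setT line.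
Proof. exact: (measurable_fun_fubini_tonelli_F weight measurable_weight weight_ge0). Qed.

Let integral_line : (\int[P]_w \int[leb]_x line (w, x) < +oo)%E.
Proof.
have i9 : P.-integrable setT (fun w => (9 * `|m w * K w|)%:E).
  by have := integrableZl measurableT 9 (integrable_norm iK).
have h : (\int[P]_w (9 * `|m w * K w|)%:E < +oo)%E.
  exact: integrable_lty i9.
apply: le_lt_trans h; apply: ge0_le_integral => //.
- by move=> w _; apply: integral_ge0 => z _; exact: line_ge0.
- exact: (measurable_fun_fubini_tonelli_F line).
- exact: measurable_int i9.
move=> w _.
pose e (z : plane) : \bar R := (bump z.1 * bump z.2 * `|uy w z.1 z.2|)%:E.
have me : measurable_fun setT e.
  apply/measurable_EFinP; apply: measurable_funM.
    by apply: measurable_funM; exact: (measurableT_comp mbump).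
  apply: measurableT_comp => //.
  exact: measurable_plane (sq_dy_contx (hu w)) (sq_dy_conty (hu w)).
have e0 z : (0 <= e z)%E by rewrite lee_fin; do 2 apply: mulr_ge0 => //; exact: bump_ge0.
have -> : (\int[leb]_x line (w, x) = \int[leb2]_z (`|m w|%:E * e z))%E.
  rewrite fubini_tonelli1//; last by move=> z; rewrite mule_ge0.
  exact: emeasurable_funM.
rewrite ge0_integralZl//.
have := weighted_cross_derivative_bound (hu w) (hv w) (K_gt0 w) (neg w).
move=> /(lee_wpmul2l _) => /(_ `|m w|%:E); rewrite lee_fin => /(_ (normr_ge0 _)) /le_trans; apply.
by rewrite -EFinM lee_fin normrM (gtr0_norm (K_gt0 w)) mulrCA.
Qed.

(* By Tonelli almost every line carries a finite weight; one of them is enough, since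
   the mean of [m * u] does not depend on [x]. *)
Let good_line : exists2 x : R, 0 < x < 1 & (\int[P]_w line (w, x) < +oo)%E.
Proof.
have fin := integral_line; rewrite (fubini_tonelli line)// in fin.
pose G x := (\int[P]_w line (w, x))%E.
have mG : measurable_fun setT G by exact: measurable_fun_fubini_tonelli_G.
have G0 x : (0 <= G x)%E by apply: integral_ge0 => w _; exact: line_ge0.
have iG : leb.-integrable setT G.
  apply/integrableP; split => //; apply: le_lt_trans fin.
  by rewrite le_eqVlt; apply/orP; left; apply/eqP; apply: eq_integral => x _; rewrite gee0_abs.
have [N [mN N0 sN]] := integrable_ae measurableT iG.
apply: contrapT => nx.
have sI : `]0, 1[%classic `<=` N.
  move=> x x01; apply: sN => /= h; apply: nx; exists x; first by move: x01; rewrite /= in_itv.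
  by have := h Logic.I; rewrite ge0_fin_numE.
have : (leb `]0%R, 1%R[%classic <= leb N)%E.
  by apply: le_measure => //; rewrite inE//; exact: measurable_itv.
by rewrite N0 lebesgue_measure_itv/= lte01 oppr0 adde0 lee_fin ler10.
Qed.

(** The direction of [y] is not the one that [u] is monotone along, so the derivative
    [uy] has no sign and need not be integrable for obvious reasons. Monotonicity of the
    pair (u, v) makes it so, by [weighted_cross_derivative_bound], and as the bound is
    linear in [K w] it can be averaged against [m]. *)
Lemma cross_invariance x a b : 0 <= x <= 1 -> 0 < a -> a < b -> b < 1 ->
  (\int[P]_w (m w * u w x a)%:E = \int[P]_w (m w * u w x b)%:E)%E.
Proof.
move=> /andP[x0 x1] a0 ab b1.
have [c /andP[c0 c1] finc] := good_line.
suff E : (\int[P]_w (m w * u w c a)%:E = \int[P]_w (m w * u w c b)%:E)%E.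
  have X y : (\int[P]_w (m w * u w x y)%:E = \int[P]_w (m w * u w c y)%:E)%E.
    have [xc|cx|->//] := ltgtP x c; first by apply: invariance_x => //; exact: ltW.
    by apply/esym; apply: invariance_x => //; exact: ltW.
  by rewrite !X.
have bc : 0 < bump c by rewrite /bump clamp_id ?(ltW c0) ?(ltW c1)// mulr_gt0// subr_gt0.
(* [1 / k] is a lower bound of the cutoff on the segment from (c, a) to (c, b) *)
pose k := (bump c * (a * (1 - b)))^-1.
have k0 : 0 < k.
  by rewrite invr_gt0; do 2 apply: mulr_gt0 => //; rewrite subr_gt0.
apply: (@segment_invariance _ _ _ _ _ (fun w y => u w c y) (fun w y => uy w c y)) => //.
- by move=> w; exact: sq_conty (hu w) c.
- by move=> w; exact: sq_dy_conty (hu w) c.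
- move=> w y /andP[ay yb]; apply: (sq_dy (hu w)).
  by rewrite (lt_trans a0 ay) (lt_trans yb b1).
pose g (z : TR) : \bar R := (k%:E * weight ((z.1, c), z.2))%E.
have mg : measurable_fun setT g.
  apply: emeasurable_funM => //; apply: (measurableT_comp measurable_weight).
  by apply: measurable_fun_pair => //; exact: measurable_fun_pair.
have g0 z : (0 <= g z)%E by rewrite mule_ge0// lee_fin ltW.
have fing : (\int[P]_w \int[leb]_y g (w, y) < +oo)%E.
  have E w : (\int[leb]_y g (w, y) = k%:E * line (w, c))%E.
    rewrite ge0_integralZl//; last by rewrite lee_fin ltW.
    exact: (measurableT_comp measurable_weight (measurable_pair1 (w, c))).
  under eq_integral do rewrite E.
  rewrite ge0_integralZl//; last by rewrite lee_fin ltW.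
    by apply: lte_mul_pinfty => //; rewrite lee_fin ltW.
  exact: (measurableT_comp measurable_line (measurable_pair2 c)).
pose g1 (z : TR) : \bar R := (`|m z.1 * uy z.1 c z.2| * \1_(`[a, b]%classic : set R) z.2)%:E.
have mg1 : measurable_fun setT g1.
  apply/measurable_EFinP; apply: measurable_funM; last first.
    by apply: measurableT_comp => //; apply: measurable_indic; exact: measurable_itv.
  apply: measurableT_comp => //; apply: measurable_funM; first exact: measurableT_comp.
  apply: (@measurable_separately_continuous _ _ R (fun w y => uy w c y)) => // w.
  exact: sq_dy_conty (hu w) c.
have g10 z : (0 <= g1 z)%E by rewrite lee_fin mulr_ge0.
apply: le_lt_trans fing.
have E1 w : (\int[leb]_(y in `[a, b]) `|m w * uy w c y|%:E = \int[leb]_y g1 (w, y))%E.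
  rewrite integral_mkcond; apply: eq_integral => y _.
  by rewrite /g1 patchE indicE; case: ifP; rewrite ?mulr1 ?mulr0.
under eq_integral do rewrite E1.
apply: ge0_le_integral => //.
- by move=> w _; apply: integral_ge0.
- exact: (measurable_fun_fubini_tonelli_F g1).
- exact: (measurable_fun_fubini_tonelli_F g).
move=> w _; apply: ge0_le_integral => //.
- exact: (measurableT_comp mg1 (measurable_pair1 w)).
- exact: (measurableT_comp mg (measurable_pair1 w)).
move=> y _; rewrite /g1 indicE; case: (boolP (y \in _)) => [/set_mem|_]; last first.
  by rewrite mulr0; exact: g0.
rewrite /= in_itv/= mulr1 => /andP[ay yb].
rewrite /g /weight /= -EFinM lee_fin normrM.
have : bump c * (a * (1 - b)) <= bump c * bump y.
  rewrite ler_wpM2l ?bump_ge0// /bump clamp_id; last first.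
    by rewrite (le_trans (ltW a0) ay) (le_trans yb (ltW b1)).
  apply: ler_pM; [exact: ltW|by rewrite subr_ge0 ltW|exact: ay|].
  by rewrite lerD2l lerN2.
have n0 : 0 <= `|m w| * `|uy w c y| by rewrite mulr_ge0.
move=> h; rewrite -[leLHS]mulr1.
have -> : k * (`|m w| * (bump c * bump y * `|uy w c y|)) =
  `|m w| * `|uy w c y| * (k * (bump c * bump y)) by ring.
apply: ler_wpM2l => //; rewrite -(ler_pM2l k0) in h.
by apply: le_trans h; rewrite /k mulVf// gt_eqF// -invr_gt0.
Qed.

End CrossInvariance.

(** * Differentiation along lines *)

Section Dot.
Context {R : realType} {N : nat}.
Implicit Types (a b c : 'rV[R]_N) (A : 'M[R]_N) (k : R).

Lemma dotE a b : dot a b = \sum_k a 0 k * b 0 k.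
Proof. by rewrite /dot mxE; apply: eq_bigr => k _; rewrite mxE. Qed.

Lemma dotDl a b c : dot (a + b) c = dot a c + dot b c.
Proof. by rewrite /dot mulmxDl mxE. Qed.

Lemma dotNl a b : dot (- a) b = - dot a b.
Proof. by rewrite /dot mulNmx mxE. Qed.

Lemma dotBl a b c : dot (a - b) c = dot a c - dot b c.
Proof. by rewrite dotDl dotNl. Qed.

Lemma dotZl k a b : dot (k *: a) b = k * dot a b.
Proof. by rewrite /dot -scalemxAl mxE. Qed.

Lemma dotC a b : dot a b = dot b a.
Proof. by rewrite !dotE; apply: eq_bigr => k _; rewrite mulrC. Qed.

Lemma dotDr a b c : dot c (a + b) = dot c a + dot c b.
Proof. by rewrite !(dotC c) dotDl. Qed.

Lemma dotNr a b : dot a (- b) = - dot a b.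
Proof. by rewrite !(dotC a) dotNl. Qed.

Lemma dotBr a b c : dot c (a - b) = dot c a - dot c b.
Proof. by rewrite dotDr dotNr. Qed.

Lemma dotZr k a b : dot a (k *: b) = k * dot a b.
Proof. by rewrite !(dotC a) dotZl. Qed.

Lemma dot0l a : dot 0 a = 0.
Proof. by rewrite /dot mul0mx mxE. Qed.

Lemma dot_suml I (r : seq I) (F : I -> 'rV[R]_N) a :
  dot (\sum_(i <- r) F i) a = \sum_(i <- r) dot (F i) a.
Proof. by elim/big_ind2 : _ => [|? ? ? ? <- <-|//]; rewrite ?dot0l ?dotDl. Qed.

Lemma dot_mulmxE a A c : dot (a *m A) c = \sum_k \sum_l a 0 l * A l k * c 0 k.
Proof. by rewrite dotE; apply: eq_bigr => k _; rewrite mxE mulr_suml. Qed.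

Lemma cvg_bigsum (U : Type) (F : set_system U) {FF : Filter F} I (r : seq I) (f : I -> U -> R)
    (l : I -> R) : (forall i, f i x @[x --> F] --> l i) ->
  \sum_(i <- r) f i x @[x --> F] --> \sum_(i <- r) l i.
Proof.
by move=> fl; apply: cvg_big => //; exact: add_continuous.
Qed.

Lemma continuous_dotl c : continuous (fun a => dot a c).
Proof.
rewrite (_ : (fun _ => _) = (fun a => \sum_k a 0 k * c 0 k)); last first.
  by apply/funext => a; rewrite dotE.
move=> a; apply: (@cvg_bigsum _ (nbhs a)) => k; apply: cvgMl; exact: coord_continuous.
Qed.

Lemma continuous_dot_mulmx a c : continuous (fun A => dot (a *m A) c).
Proof.
rewrite (_ : (fun _ => _) = (fun A => \sum_k \sum_l a 0 l * A l k * c 0 k)); last first.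
  by apply/funext => A; rewrite dot_mulmxE.
move=> A; apply: (@cvg_bigsum _ (nbhs A)) => k; apply: (@cvg_bigsum _ (nbhs A)) => l.
apply: cvgMl; apply: cvgMr; exact: coord_continuous.
Qed.

Lemma is_derive_dot (f : 'rV[R]_N -> 'rV[R]_N) p a c : differentiable f p ->
  is_derive p a (fun p => dot (f p) c) (dot (a *m 'J f p) c).
Proof.
move=> df; have da : derivable f p a by exact: diff_derivable.
have H : h^-1 *: (dot (f (h *: a + p)) c - dot (f p) c) @[h --> 0^'] --> dot (a *m 'J f p) c.
  have -> : (fun h : R => h^-1 *: (dot (f (h *: a + p)) c - dot (f p) c)) =
      (fun h => dot (h^-1 *: (f (h *: a + p) - f p)) c).
    by apply/funext => h; rewrite dotZl dotBl.
  apply: (continuous_cvg _ (@continuous_dotl c _)).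
  by rewrite -deriveEjacobian.
apply: DeriveDef; first by apply/cvg_ex; eexists; exact: H.
exact: (cvg_lim _ H).
Qed.

(** The curve is only required to be a line of direction [a] near [t], as clamped lines
    are. *)
Lemma is_derive_line (f : 'rV[R]_N -> R) (g : R -> 'rV[R]_N) (t : R) a df :
  (\forall h \near (0 : R), g (h + t) = h *: a + g t) ->
  is_derive (g t) a f df -> is_derive t 1 (fun t => f (g t)) df.
Proof.
move=> gt [/cvg_ex[l fl] fdf].
have H : h^-1 *: (f (g (h *: 1 + t)) - f (g t)) @[h --> 0^'] --> df.
  have : h^-1 *: (f (h *: a + g t) - f (g t)) @[h --> 0^'] --> df.
    by rewrite -fdf /derive; apply/cvg_ex; exists l.
  apply: cvg_trans; apply: near_eq_cvg; apply: nbhs_dnbhs; near=> h.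
  rewrite [h%:A]mulr1; congr (_ *: (f _ - _)); apply/esym; near: h; exact: gt.
apply: DeriveDef; first by apply/cvg_ex; eexists; exact: H.
exact: (cvg_lim _ H).
Unshelve. all: by end_near. Qed.

End Dot.

(** * Parallelograms in a convex set *)

Section Convexity.
Context {R : realType} {N : nat} (Pi : set 'rV[R]_N).
Hypothesis Pi_open : open Pi.
Hypothesis Pi_convex : convex_set (Pi : set (convex_lmodType 'rV[R]_N)).

Lemma convex_segment (p p' : 'rV[R]_N) (t : R) : Pi p -> Pi p' -> 0 <= t <= 1 ->
  Pi (p' + t *: (p - p')).
Proof.
move=> Pp Pp' /andP[t0 t1].
pose k : {i01 R} := @Itv01 R t t0 t1.
have := Pi_convex k (mem_set Pp) (mem_set Pp').
move=> /set_mem; congr Pi.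
transitivity (t *: p + (1 - t) *: p'); first by [].
by rewrite scalerBl scale1r scalerBr addrCA addrA.
Qed.

(** The segment is thickened in the direction [e] and prolonged at both ends, by steps
    [del] that are small with respect to balls around its ends. The parallelogram is
    parametrized by the unit square, with a margin [s] on all sides. *)
Lemma segment_in_parallelogram (p0 p1 e : 'rV[R]_N) : Pi p0 -> Pi p1 ->
  exists q r b s y0 y1, [/\ 0 < s, 0 < r,
    forall x y : R, - s <= x <= 1 + s -> - s <= y <= 1 + s -> Pi (q + x *: (r *: e) + y *: b),
    0 < y0 /\ y0 < y1 & y1 < 1 /\
    p0 = q + 2^-1 *: (r *: e) + y0 *: b /\ p1 = q + 2^-1 *: (r *: e) + y1 *: b].
Proof.
move=> P0 P1; pose v := p1 - p0.
have ballPi p : Pi p -> exists2 eps, 0 < eps & forall h : 'rV[R]_N, `|h| < eps -> Pi (p + h).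
  move=> Pp; have /nbhs_ballP[eps /= e0 he] := open_nbhs_nbhs (conj Pi_open Pp).
  exists eps => // h heps; apply: he; rewrite -ball_normE /=.
  by rewrite opprD addrA subrr sub0r normrN.
have [e0 e0_gt0 h0] := ballPi _ P0; have [e1 e1_gt0 h1] := ballPi _ P1.
pose del := Num.min e0 e1 / (3 * (`|v| + `|e| + 1)).
have c_gt0 : 0 < 3 * (`|v| + `|e| + 1) by rewrite mulr_gt0// ltr_wpDl// addr_ge0.
have del_gt0 : 0 < del by rewrite divr_gt0// lt_min e0_gt0.
have small t k : `|t| <= 2 * del -> `|k| <= 3 * del ->
    `|t *: v + k *: e| < Num.min e0 e1.
  move=> td kd; apply: le_lt_trans (ler_normD _ _) _; rewrite !normrZ.
  have -> : Num.min e0 e1 = del * (3 * (`|v| + `|e| + 1)) by rewrite divfK// gt_eqF.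
  apply: (@le_lt_trans _ _ (2 * del * `|v| + 3 * del * `|e|)).
    by apply: lerD; apply: ler_wpM2r.
  have := mulr_ge0 (ltW del_gt0) (normr_ge0 v); lra.
have tube c t k : 0 <= c <= 1 -> `|t| <= 2 * del -> `|k| <= 3 * del ->
    Pi (p0 + c *: v + (t *: v + k *: e)).
  move=> c01 td kd; have sm := small _ _ td kd.
  have Pa : Pi (p0 + (t *: v + k *: e)).
    by apply: h0; apply: lt_le_trans sm _; rewrite ge_min lexx.
  have Pb : Pi (p1 + (t *: v + k *: e)).
    by apply: h1; apply: lt_le_trans sm _; rewrite ge_min lexx orbT.
  have := convex_segment Pb Pa c01.
  by rewrite opprD addrACA subrr addr0 -/v addrAC.
exists (p0 - del *: v - del *: e), (2 * del), ((1 + 2 * del) *: v), (del / (1 + 2 * del)),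
  (del / (1 + 2 * del)), ((1 + del) / (1 + 2 * del)).
have d_gt0 : 0 < 1 + 2 * del by rewrite ltr_wpDr// mulr_ge0// ltW.
have dn0 : 1 + 2 * del != 0 by rewrite gt_eqF.
split; first by rewrite divr_gt0.
- by rewrite mulr_gt0.
- move=> x y /andP[x0 x1] /andP[y0 y1].
  pose s := del / (1 + 2 * del).
  have s0 : 0 < s by rewrite divr_gt0.
  have sd : s * (1 + 2 * del) = del by rewrite /s divfK.
  have s2 : s <= 2^-1 by rewrite ler_pdivrMr//; lra.
  pose t := (1 + 2 * del) * y - del.
  have t0 : - (2 * del) <= t.
    have : (1 + 2 * del) * - s <= (1 + 2 * del) * y by rewrite ler_pM2l.
    by rewrite /t mulrN [_ * s]mulrC sd; lra.
  have t1 : t <= 1 + 2 * del.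
    have : (1 + 2 * del) * y <= (1 + 2 * del) * (1 + s) by rewrite ler_pM2l.
    by rewrite /t mulrDr mulr1 [_ * s]mulrC sd; lra.
  have -> : p0 - del *: v - del *: e + x *: ((2 * del) *: e) + y *: ((1 + 2 * del) *: v) =
    p0 + clamp t *: v + ((t - clamp t) *: v + (del * (2 * x - 1)) *: e).
    by apply/rowP => j; rewrite !mxE /t; ring.
  apply: tube; first by rewrite clamp_ge0 clamp_le1.
    case: (clampP t) => -[h ->]; rewrite ?subrr ?normr0 ?subr0.
    - by rewrite ler0_norm//; lra.
    - by rewrite mulr_ge0// ltW.
    - by rewrite ger0_norm ?subr_ge0//; lra.
  rewrite normrM (gtr0_norm del_gt0) mulrC ler_pM2r//.
  by rewrite ler_norml; apply/andP; split; rewrite -/s in x0 x1; lra.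
- by split; [rewrite divr_gt0|rewrite ltr_pM2r ?invr_gt0//; lra].
split; first by rewrite ltr_pdivrMr//; lra.
have mid : p0 - del *: v - del *: e + 2^-1 *: ((2 * del) *: e) = p0 - del *: v.
  by rewrite scalerA mulrA mulVf ?mul1r// subrK.
split; rewrite mid scalerA divfK//.
  by rewrite subrK.
by rewrite scalerDl scale1r addrA addrAC addrNK /v addrC subrK.
Qed.

End Convexity.

(** * Plane sections of a monotone field *)

(** A point of the inner square, moved by a small [(t1, t2)], is a convex combination of
    the corners of the outer square. The combination of the monotonicity inequalities
    between the point and the corners, with the same weights, is the claim. *)
Lemma corner_bound (R : realType) (s x y U V : R) (u v : bool -> bool -> R) :
  let cor (i : bool) := if i then 1 + s else - s in
  0 < s -> 0 <= x <= 1 -> 0 <= y <= 1 ->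
  (forall i j, (U - u i j) * (x - cor i) + (V - v i j) * (y - cor j) <= 0) ->
  forall t1 t2, - s <= t1 <= s -> - s <= t2 <= s ->
  U * t1 + V * t2 <= (1 + 2 * s) * \sum_(i : bool) \sum_(j : bool) (`|u i j| + `|v i j|).
Proof.
move=> cor s0 /andP[x0 x1] /andP[y0 y1] H t1 t2 /andP[t1s st1] /andP[t2s st2].
have l0 : 0 < 1 + 2 * s by lra.
pose th t z : R := (z - t + s) / (1 + 2 * s).
have th01 t z : - s <= t <= s -> 0 <= z <= 1 -> 0 <= th t z <= 1.
  move=> /andP[? ?] /andP[? ?]; rewrite /th divr_ge0 ?(ltW l0)//; last by lra.
  by rewrite ler_pdivrMr//; lra.
pose w (t : R) (i : bool) := if i then t else 1 - t.
have w01 t i : 0 <= t <= 1 -> 0 <= w t i <= 1.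
  by move=> /andP[? ?]; case: i => /=; apply/andP; split; lra.
set A := th t1 x; set B := th t2 y.
have A01 : 0 <= A <= 1 by apply: th01; apply/andP.
have B01 : 0 <= B <= 1 by apply: th01; apply/andP.
have dist z i : 0 <= z <= 1 -> `|z - cor i| <= 1 + 2 * s.
  by move=> /andP[? ?]; rewrite ler_norml; case: i => /=; apply/andP; split; lra.
have main i j : w A i * w B j * (U * (x - cor i) + V * (y - cor j)) <=
    (1 + 2 * s) * (`|u i j| + `|v i j|).
  have /andP[a0 a1] := w01 A i A01; have /andP[b0 b1] := w01 B j B01.
  have W0 : 0 <= w A i * w B j by exact: mulr_ge0.
  have W1 : w A i * w B j <= 1 by exact: mulr_ile1.
  have h := ler_wpM2l W0 (H i j); rewrite mulr0 in h.
  have e : u i j * (x - cor i) + v i j * (y - cor j) <= (1 + 2 * s) * (`|u i j| + `|v i j|).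
    apply: le_trans (ler_norm _) _; apply: le_trans (ler_normD _ _) _.
    rewrite !normrM mulrDr; apply: lerD; rewrite mulrC; apply: ler_wpM2r => //;
    by apply: dist; apply/andP.
  have e0 : 0 <= (1 + 2 * s) * (`|u i j| + `|v i j|).
    by apply: mulr_ge0; [exact: ltW|exact: addr_ge0].
  have h2 : w A i * w B j * (u i j * (x - cor i) + v i j * (y - cor j)) <=
      (1 + 2 * s) * (`|u i j| + `|v i j|).
    apply: le_trans (ler_wpM2l W0 e) _.
    by rewrite -[leRHS]mul1r; apply: ler_wpM2r.
  by move: h h2; rewrite !mulrDr !mulrBl !mulrDr; lra.
rewrite !big_bool /= !mulrDr.
have := lerD (lerD (main true true) (main true false)) (lerD (main false true) (main false false)).
rewrite !mulrDr; apply: le_trans; rewrite le_eqVlt; apply/orP; left; apply/eqP.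
rewrite /w /cor /A /B /th; field.
by rewrite gt_eqF.
Qed.

Section MonotoneField.
Context {R : realType} {N : nat} (Pi : set 'rV[R]_N).
Hypothesis Pi_convex : convex_set (Pi : set (convex_lmodType 'rV[R]_N)).
Variable f : 'rV[R]_N -> 'rV[R]_N.
Hypothesis df : forall p, Pi p -> differentiable f p.
Hypothesis cJ : forall p, Pi p -> {for p, continuous (fun p => 'J f p)}.
Hypothesis neg : forall p, Pi p -> forall v, dot (v *m 'J f p) v <= 0.

Lemma is_derive_clamped_line (p a c : 'rV[R]_N) (x : R) : 0 < x < 1 -> Pi (p + x *: a) ->
  is_derive x 1 (fun x => dot (f (p + clamp x *: a)) c)
    (dot (a *m 'J f (p + clamp x *: a)) c).
Proof.
move=> /andP[x0 x1] Px.
have cx : clamp x = x by rewrite clamp_id// !ltW.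
apply: (@is_derive_line _ _ (fun p => dot (f p) c) (fun x => p + clamp x *: a) x a).
  near=> h; rewrite cx clamp_id.
    by rewrite scalerDl addrCA.
  have hx : `|0 - h| < Num.min x (1 - x).
    by near: h; apply: cvgr_dist_lt; [exact: cvg_id|rewrite lt_min x0 subr_gt0].
  move: hx; rewrite sub0r normrN lt_min !ltr_norml => /andP[/andP[? ?] /andP[? ?]].
  by apply/andP; split; lra.
by apply: is_derive_dot; rewrite cx; exact: df.
Unshelve. all: by end_near. Qed.

Lemma continuous_clamped_line (p a : 'rV[R]_N) : continuous (fun x : R => p + clamp x *: a).
Proof.
by move=> x; apply: cvgD; [exact: cvg_cst|apply: cvgZl; exact: continuous_clamp].
Qed.

Lemma continuous_field_comp (U : topologicalType) (g : U -> 'rV[R]_N) (c : 'rV[R]_N) :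
  continuous g -> (forall t, Pi (g t)) -> continuous (fun t => dot (f (g t)) c).
Proof.
move=> cg Pg t; have cf := differentiable_continuous (df (Pg t)).
exact: (continuous_cvg _ (@continuous_dotl _ _ c _) (continuous_cvg _ cf (cg t))).
Qed.

Lemma continuous_jacobian_comp (U : topologicalType) (g : U -> 'rV[R]_N) (a c : 'rV[R]_N) :
  continuous g -> (forall t, Pi (g t)) -> continuous (fun t => dot (a *m 'J f (g t)) c).
Proof.
move=> cg Pg t.
exact: (continuous_cvg _ (@continuous_dot_mulmx _ _ a c _) (continuous_cvg _ (cJ (Pg t)) (cg t))).
Qed.

Lemma monotone_field p p' : Pi p -> Pi p' -> dot (f p - f p') (p - p') <= 0.
Proof.
move=> Pp Pp'; pose v := p - p'.
have Pt (t : R) : Pi (p' + clamp t *: v).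
  by apply: convex_segment => //; rewrite clamp_ge0 clamp_le1.
pose g (t : R) := dot (f (p' + clamp t *: v)) v.
pose dg (t : R) := dot (v *m 'J f (p' + clamp t *: v)) v.
have cg : continuous g.
  by apply: continuous_field_comp Pt; exact: continuous_clamped_line.
have dgg (t : R) : t \in `]0, 1[%R -> is_derive t 1 g (dg t).
  rewrite in_itv/= => t01; apply: is_derive_clamped_line => //.
  by case/andP: t01 => t0 t1; have := Pt t; rewrite clamp_id// !ltW.
have [t _] := MVT ltr01 dgg (continuous_subspaceT cg).
rewrite subr0 mulr1 /g clamp_gt1// clamp_lt0// scale1r scale0r addr0.
have -> : p' + v = p by rewrite /v addrC subrK.
by rewrite -dotBl => ->; exact: neg.
Qed.

Section Square.
Variables (q a b : 'rV[R]_N) (s : R).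
Hypothesis s_gt0 : 0 < s.
Hypothesis square_Pi : forall x y : R, - s <= x <= 1 + s -> - s <= y <= 1 + s ->
  Pi (q + x *: a + y *: b).

Definition square_point (x y : R) : 'rV[R]_N := q + clamp x *: a + clamp y *: b.

Lemma square_point_in x y : Pi (square_point x y).
Proof.
have h (t : R) : - s <= clamp t <= 1 + s.
  rewrite (le_trans _ (clamp_ge0 t)) ?oppr_le0 ?(ltW s_gt0)//=.
  by rewrite (le_trans (clamp_le1 t))// lerDl ltW.
exact: square_Pi.
Qed.

Lemma continuous_square_point : continuous (fun z : R * R => square_point z.1 z.2).
Proof.
have c1 : continuous (fun z : R * R => clamp z.1).
  by move=> z; apply: (continuous_cvg _ (@continuous_clamp _ _)); exact: cvg_fst.
have c2 : continuous (fun z : R * R => clamp z.2).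
  by move=> z; apply: (continuous_cvg _ (@continuous_clamp _ _)); exact: cvg_snd.
move=> z; apply: cvgD; last by apply: cvgZl; exact: c2.
by apply: cvgD; [exact: cvg_cst|apply: cvgZl; exact: c1].
Qed.

Lemma continuous_square_pointx y : continuous (square_point^~ y).
Proof.
move=> x; apply: cvgD; last exact: cvg_cst.
exact: continuous_clamped_line.
Qed.

Lemma continuous_square_pointy x : continuous (square_point x).
Proof. exact: continuous_clamped_line. Qed.

Lemma jacobian_bounded a' c : exists L, forall x y,
  `|dot (a' *m 'J f (square_point x y)) c| <= L.
Proof.
have cpt : compact (`[0, 1]%classic `*` `[0, 1]%classic : set (R * R)).
  by apply: compact_setX; exact: segment_compact.
have cg : continuous (fun z : R * R => dot (a' *m 'J f (square_point z.1 z.2)) c : R^o).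
  apply: continuous_jacobian_comp; first exact: continuous_square_point.
  by move=> z; exact: square_point_in.
have := continuous_compact (continuous_subspaceT cg) cpt.
move=> /compact_bounded[M [_ hM]]; exists (M + 1) => x y.
apply: (hM (M + 1)); first by rewrite ltrDl.
exists (clamp x, clamp y) => /=; last by rewrite /square_point !clampK.
by split; rewrite /= in_itv/= clamp_ge0 clamp_le1.
Qed.

Lemma square_C1_field c : exists L0, forall K L, L0 <= L ->
  (forall x y, `|dot (f (square_point x y)) c| <= K) ->
  square_C1 (fun x y => dot (f (square_point x y)) c)
    (fun x y => dot (a *m 'J f (square_point x y)) c)
    (fun x y => dot (b *m 'J f (square_point x y)) c) K L.
Proof.
have [L1 hL1] := jacobian_bounded a c; have [L2 hL2] := jacobian_bounded b c.
exists (Num.max L1 L2) => K L; rewrite ge_max => /andP[L1L L2L] hK.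
have Pin := square_point_in.
have comm x y : square_point x y = q + clamp y *: b + clamp x *: a by rewrite /square_point addrAC.
split => //.
- by move=> x y; rewrite /square_point !clampK.
- by move=> y; apply: continuous_field_comp => //; exact: continuous_square_pointx.
- by move=> x; apply: continuous_field_comp => //; exact: continuous_square_pointy.
- by move=> y; apply: continuous_jacobian_comp => //; exact: continuous_square_pointx.
- by move=> x; apply: continuous_jacobian_comp => //; exact: continuous_square_pointy.
- by move=> y; apply: continuous_jacobian_comp => //; exact: continuous_square_pointx.
- by move=> x; apply: continuous_jacobian_comp => //; exact: continuous_square_pointy.
- move=> x y x01; rewrite comm; under eq_fun do rewrite comm.
  apply: is_derive_clamped_line => //; have := Pin x y; rewrite comm.
  by case/andP: x01 => x0 x1; rewrite (@clamp_id _ x)// !ltW.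
- move=> x y y01; apply: is_derive_clamped_line => //; have := Pin x y.
  by case/andP: y01 => y0 y1; rewrite /square_point (@clamp_id _ y)// !ltW.
- move=> x y /andP[x0 x1] /andP[y0 y1].
  have cx : clamp x = x by rewrite clamp_id// !ltW.
  have cy : clamp y = y by rewrite clamp_id// !ltW.
  rewrite -dotDl -mulmxDl.
  apply: (@is_derive_line _ _ (fun p => dot (f p) c)
    (fun t => square_point (x + t) (y + t)) 0 (a + b)).
    near=> h.
    have hx : `|0 - h| < Num.min (Num.min x (1 - x)) (Num.min y (1 - y)).
      near: h; apply: cvgr_dist_lt; first exact: cvg_id.
      by rewrite !lt_min x0 y0 !subr_gt0 x1.
    move: hx; rewrite sub0r normrN !lt_min !ltr_norml.
    move=> /andP[/andP[/andP[? ?] /andP[? ?]] /andP[/andP[? ?] /andP[? ?]]].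
    rewrite /square_point !addr0 cx cy !clamp_id; try by apply/andP; split; lra.
    by apply/rowP => j; rewrite !mxE; ring.
  by rewrite !addr0; apply: is_derive_dot; exact: df.
- by move=> x y; exact: le_trans L1L.
- by move=> x y; exact: le_trans L2L.
Unshelve. all: by end_near. Qed.

Definition corner (i j : bool) : 'rV[R]_N :=
  q + (if i then 1 + s else - s) *: a + (if j then 1 + s else - s) *: b.

Definition corner_size : R := \sum_(i : bool) \sum_(j : bool)
  (`|dot (f (corner i j)) a| + `|dot (f (corner i j)) b|).

Lemma corner_size_ge0 : 0 <= corner_size.
Proof. by do 2 apply: sumr_ge0 => ? _; exact: addr_ge0. Qed.

(** A monotone field is bounded on the inner square by its values at four points, which
    are integrable even when suprema of the field are not known to be. *)
Lemma field_bound x y (c : 'rV[R]_N) : c = a \/ c = b ->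
  `|dot (f (square_point x y)) c| <= 1 + (1 + 2 * s) / s * corner_size.
Proof.
move=> hc; have s0 : 0 < s by exact: s_gt0.
have cb := @corner_bound R s (clamp x) (clamp y) (dot (f (square_point x y)) a)
  (dot (f (square_point x y)) b) (fun i j => dot (f (corner i j)) a)
  (fun i j => dot (f (corner i j)) b).
have {}cb t1 t2 : - s <= t1 <= s -> - s <= t2 <= s ->
    dot (f (square_point x y)) a * t1 + dot (f (square_point x y)) b * t2 <=
    (1 + 2 * s) * corner_size.
  apply: cb => //; rewrite ?clamp_ge0 ?clamp_le1// => i j.
  have Pc : Pi (corner i j).
    by apply: square_Pi; case: i; case: j; apply/andP; split; lra.
  have := monotone_field (square_point_in x y) Pc; congr (_ <= 0).
  rewrite !dotBl; set D := f _; set D' := f _.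
  have -> : square_point x y - corner i j = (clamp x - (if i then 1 + s else - s)) *: a +
      (clamp y - (if j then 1 + s else - s)) *: b.
    by apply/rowP => k; rewrite !mxE; ring.
  by rewrite !dotDr !dotZr; ring.
have s1 : - s <= s <= s by apply/andP; split; lra.
have s2 : - s <= - s <= s by apply/andP; split; lra.
have s3 : - s <= 0 <= s by apply/andP; split; lra.
have -> : (1 + 2 * s) / s * corner_size = (1 + 2 * s) * corner_size / s by rewrite mulrAC.
suff h : `|dot (f (square_point x y)) c| <= (1 + 2 * s) * corner_size / s.
  by apply: le_trans h _; rewrite lerDr.
move: hc; rewrite ler_pdivlMr// -(ger0_norm (ltW s_gt0)) -normrM ler_norml.
rewrite lerNl -mulrN (ger0_norm (ltW s_gt0)).
case=> ->; apply/andP; split.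
- by have := cb _ _ s2 s3; rewrite mulr0 addr0.
- by have := cb _ _ s1 s3; rewrite mulr0 addr0.
- by have := cb _ _ s3 s2; rewrite mulr0 add0r.
- by have := cb _ _ s3 s1; rewrite mulr0 add0r.
Qed.

End Square.
End MonotoneField.

(** * Covariances with a random monotone field *)

Section RandomField.
Context d (T : measurableType d) (R : realType) (P : probability T R) (N : nat).
Variables (Pi : set 'rV[R]_N) (m : T -> R) (D : T -> 'rV[R]_N -> 'rV[R]_N).
Hypothesis Pi_open : open Pi.
Hypothesis Pi_convex : convex_set (Pi : set (convex_lmodType 'rV[R]_N)).
Hypothesis dD : forall w p, Pi p -> differentiable (D w) p.
Hypothesis cJ : forall w p, Pi p -> {for p, continuous (fun p => 'J (D w) p)}.
Hypothesis neg : forall w p, Pi p -> forall v, dot (v *m 'J (D w) p) v <= 0.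
Hypothesis mm : measurable_fun setT m.
Hypothesis mD : forall p, Pi p -> forall k, measurable_fun setT (fun w => D w p 0 k).
Hypothesis mJ : forall p, Pi p -> forall l k, measurable_fun setT (fun w => 'J (D w) p l k).
Hypothesis im : P.-integrable setT (EFin \o m).
Hypothesis iD : forall p, Pi p -> forall k, P.-integrable setT (fun w => (m w * D w p 0 k)%:E).
Hypothesis iJ : forall p, Pi p -> forall l k,
  P.-integrable setT (fun w => (m w * 'J (D w) p l k)%:E).
Hypothesis J_centered : forall p, Pi p -> forall l k,
  (\int[P]_w (m w * 'J (D w) p l k)%:E = 0)%E.

Let measurable_bigsum (I : Type) (r : seq I) (F : I -> T -> R) :
  (forall i, measurable_fun setT (F i)) -> measurable_fun setT (fun w => \sum_(i <- r) F i w).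
Proof. by move=> mF; exact: measurable_sum. Qed.

Let integrable_bigsum (I : Type) (r : seq I) (F : I -> T -> R) :
  (forall i, P.-integrable setT (EFin \o F i)) ->
  P.-integrable setT (fun w => (\sum_(i <- r) F i w)%:E).
Proof.
move=> iF; rewrite (_ : (fun w => _) = (fun w => (\sum_(i <- r) (F i w)%:E)%E)).
  by apply: integrable_sum => // i _; exact: iF.
by apply/funext => w; rewrite sumEFin.
Qed.

Let integral_bigsum0 (I : Type) (r : seq I) (F : I -> T -> R) :
  (forall i, P.-integrable setT (EFin \o F i)) ->
  (forall i, \int[P]_w (F i w)%:E = 0)%E ->
  (\int[P]_w (\sum_(i <- r) F i w)%:E = 0)%E.
Proof.
move=> iF F0; under eq_integral do rewrite -sumEFin.
by rewrite integral_sum//; apply: big1 => i _; exact: F0.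
Qed.

Let measurable_dot p c : Pi p -> measurable_fun setT (fun w => dot (D w p) c).
Proof.
move=> Pp; under eq_fun do rewrite dotE; apply: measurable_bigsum => k.
by apply: measurable_funM => //; exact: mD.
Qed.

Let integrable_dot p c : Pi p -> P.-integrable setT (fun w => (m w * dot (D w p) c)%:E).
Proof.
move=> Pp; rewrite (_ : (fun w => _) = (fun w => (\sum_k m w * D w p 0 k * c 0 k)%:E)).
  apply: integrable_bigsum => k.
  have := integrableZl measurableT (c 0 k) (iD Pp k).
  by congr (integrable _ _ _); apply/funext => w /=; rewrite -EFinM mulrC.
apply/funext => w; rewrite dotE mulr_sumr; congr EFin.
by apply: eq_bigr => k _; rewrite mulrA.
Qed.

Let measurable_jac p a c : Pi p -> measurable_fun setT (fun w => dot (a *m 'J (D w) p) c).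
Proof.
move=> Pp; under eq_fun do rewrite dot_mulmxE; apply: measurable_bigsum => k.
apply: measurable_bigsum => l; apply: measurable_funM => //.
by apply: measurable_funM => //; exact: mJ.
Qed.

Let jac_centered p a c : Pi p -> (\int[P]_w (m w * dot (a *m 'J (D w) p) c)%:E = 0)%E.
Proof.
move=> Pp.
have E w : m w * dot (a *m 'J (D w) p) c =
    \sum_k \sum_l a 0 l * c 0 k * (m w * 'J (D w) p l k).
  rewrite dot_mulmxE mulr_sumr; apply: eq_bigr => k _; rewrite mulr_sumr.
  by apply: eq_bigr => l _; ring.
under eq_integral do rewrite E.
have iZ k l : P.-integrable setT (EFin \o (fun w => a 0 l * c 0 k * (m w * 'J (D w) p l k))).
  by have := integrableZl measurableT (a 0 l * c 0 k) (iJ Pp l k).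
apply: integral_bigsum0 => k; first exact: integrable_bigsum.
apply: integral_bigsum0 => l //.
under eq_integral do rewrite EFinM.
by rewrite (integralZl measurableT (iJ Pp l k)) (J_centered Pp l k) mule0.
Qed.

(** If the gradients of a random monotone field are uncorrelated with a weight, then the
    covariances of the field with the weight are constant on an open convex set. The
    gradients need not be dominated, so they cannot be differentiated under the
    expectation pointwise; instead each component [k] is compared at [p0] and [p1] through
    the two-dimensional section spanned by the direction of [k] and by [p1 - p0], on
    which [cross_invariance] applies. *)
Lemma weighted_mean_constant p0 p1 k : Pi p0 -> Pi p1 ->
  (\int[P]_w (m w * D w p0 0 k)%:E = \int[P]_w (m w * D w p1 0 k)%:E)%E.
Proof.
move=> P0 P1.
have [q [r [b [s [y0 [y1]]]]]] :=
  segment_in_parallelogram Pi_open Pi_convex (delta_mx 0 k) P0 P1.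
set a := r *: _ => -[s0 r0 sq [y0_gt0 y01] [y1_lt1 [E0 E1]]].
pose pt := square_point q a b.
have Ppt x y : Pi (pt x y) by exact: square_point_in sq _ _.
pose K w := 1 + (1 + 2 * s) / s * corner_size (D w) q a b s.
have hK w x y c : c = a \/ c = b -> `|dot (D w (pt x y)) c| <= K w.
  exact: (field_bound Pi_convex (@dD w) (@neg w) s0 sq).
have K_gt0 w : 0 < K w.
  by rewrite ltr_wpDr// !mulr_ge0 ?corner_size_ge0 ?invr_ge0// ?(ltW s0)// addr_ge0// mulr_ge0// ltW.
have [L hL] : exists L : T -> R, forall w,
    square_C1 (fun x y => dot (D w (pt x y)) a) (fun x y => dot (a *m 'J (D w) (pt x y)) a)
      (fun x y => dot (b *m 'J (D w) (pt x y)) a) (K w) (L w) /\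
    square_C1 (fun x y => dot (D w (pt x y)) b) (fun x y => dot (a *m 'J (D w) (pt x y)) b)
      (fun x y => dot (b *m 'J (D w) (pt x y)) b) (K w) (L w).
  suff h : forall w, exists L : R,
    square_C1 (fun x y => dot (D w (pt x y)) a) (fun x y => dot (a *m 'J (D w) (pt x y)) a)
      (fun x y => dot (b *m 'J (D w) (pt x y)) a) (K w) L /\
    square_C1 (fun x y => dot (D w (pt x y)) b) (fun x y => dot (a *m 'J (D w) (pt x y)) b)
      (fun x y => dot (b *m 'J (D w) (pt x y)) b) (K w) L.
    by have [L hL] := choice h; exists L.
  move=> w; have [L1 h1] := square_C1_field (@dD w) (@cJ w) s0 sq a.
  have [L2 h2] := square_C1_field (@dD w) (@cJ w) s0 sq b.
  exists (Num.max L1 L2); split.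
    by apply: h1; [rewrite le_max lexx|move=> x y; apply: hK; left].
  by apply: h2; [rewrite le_max lexx orbT|move=> x y; apply: hK; right].
have Pc i j : Pi (corner q a b s i j).
  by apply: sq; [case: i|case: j]; apply/andP; split; lra.
have iK : P.-integrable setT (fun w => (m w * K w)%:E).
  have inorm p c : Pi p -> P.-integrable setT (EFin \o (fun w => m w * `|dot (D w p) c|)).
    move=> Pp; apply: (le_integrable measurableT _ _ (integrable_dot c Pp)).
      apply/measurable_EFinP; apply: measurable_funM => //.
      by apply: measurableT_comp => //; exact: measurable_dot.
    by move=> w _ /=; rewrite !normrM normr_id.
  have E w : m w * K w = m w + (1 + 2 * s) / s * \sum_(i : bool) \sum_(j : bool)
      (m w * `|dot (D w (corner q a b s i j)) a| + m w * `|dot (D w (corner q a b s i j)) b|).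
    rewrite /K /corner_size mulrDr mulr1 mulrCA; congr (_ + _ * _).
    rewrite mulr_sumr; apply: eq_bigr => i _; rewrite mulr_sumr; apply: eq_bigr => j _.
    by rewrite mulrDr.
  rewrite (_ : (fun w => _) = EFin \o m \+ (fun w => ((1 + 2 * s) / s)%:E *
      (\sum_(i : bool) \sum_(j : bool) (m w * `|dot (D w (corner q a b s i j)) a| +
         m w * `|dot (D w (corner q a b s i j)) b|))%:E))%E; last first.
    by apply/funext => w; rewrite E.
  apply: integrableD => //; apply: integrableZl => //.
  apply: integrable_bigsum => i; apply: integrable_bigsum => j.
  by apply: (integrableD measurableT (inorm _ a (Pc i j)) (inorm _ b (Pc i j))).
have main := @cross_invariance _ T R P m
  (fun w x y => dot (D w (pt x y)) a) (fun w x y => dot (a *m 'J (D w) (pt x y)) a)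
  (fun w x y => dot (b *m 'J (D w) (pt x y)) a)
  (fun w x y => dot (D w (pt x y)) b) (fun w x y => dot (a *m 'J (D w) (pt x y)) b)
  (fun w x y => dot (b *m 'J (D w) (pt x y)) b) K L (fun w => (hL w).1) (fun w => (hL w).2) K_gt0.
have {}main := main _ mm (fun x y => measurable_dot a (Ppt x y))
  (fun x y => measurable_jac a a (Ppt x y)) (fun x y => measurable_jac b a (Ppt x y)) iK
  (fun x y => jac_centered a a (Ppt x y)) (fun x y => jac_centered b a (Ppt x y)) 2^-1 y0 y1.
have half : 0 <= (2^-1 : R) <= 1.
  by rewrite invr_ge0 ler0n invf_le1 ?ltr0n// ler1n.
have E (p : 'rV[R]_N) : Pi p -> (\int[P]_w (m w * dot (D w p) a)%:E =
    r%:E * \int[P]_w (m w * D w p 0 k)%:E)%E.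
  move=> Pp; rewrite -integralZl//; last exact: iD.
  apply: eq_integral => w _; rewrite -EFinM; congr EFin.
  rewrite /a dotZr dotE (bigD1 k)//= mxE !eqxx mulr1 big1 ?addr0; last first.
    by move=> j jk; rewrite mxE eqxx (negbTE jk) mulr0.
  by rewrite mulrCA.
have pt0 : pt 2^-1 y0 = p0.
  by rewrite /pt /square_point !clamp_id ?E0// (ltW y0_gt0) (ltW (lt_trans y01 y1_lt1)).
have pt1 : pt 2^-1 y1 = p1.
  by rewrite /pt /square_point !clamp_id ?E1// (ltW y1_lt1) (ltW (lt_trans y0_gt0 y01)).
rewrite pt0 pt1 !E// in main.
have : (r%:E * \int[P]_w (m w * D w p0 0 k)%:E = r%:E * \int[P]_w (m w * D w p1 0 k)%:E)%E.
  apply: main => // w x y t1 t2.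
  have := neg w (Ppt x y) (t1 *: a + t2 *: b); apply: le_trans.
  rewrite le_eqVlt; apply/orP; left; apply/eqP.
  by rewrite mulmxDl -!scalemxAl dotDl !dotDr !dotZl !dotZr; ring.
rewrite -(fineK (integrable_fin_num measurableT (iD P0 k))).
rewrite -(fineK (integrable_fin_num measurableT (iD P1 k))) -!EFinM => -[].
by move=> /mulfI -> //; rewrite gt_eqF.
Qed.

End RandomField.

(** * Means, Jacobians and discharge vectors *)

Lemma max_sup (R : realType) (E : set R) x : E x -> ubound E x -> sup E = x.
Proof.
move=> Ex ub; apply/eqP; rewrite eq_le; apply/andP; split.
  by apply: ge_sup => //; exists x.
by apply: ub_le_sup => //; exists x.
Qed.

Lemma jacobian_sum (R : realType) (N n : nat) (f : 'I_n -> 'rV[R]_N -> 'rV[R]_N) p :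
  (forall i, differentiable (f i) p) ->
  'J (fun p => \sum_i f i p) p = \sum_i 'J (f i) p.
Proof.
move=> df.
have E : (fun p => \sum_i f i p) = \sum_i f i by apply/funext => x; rewrite fct_sumE.
have dsum : differentiable (\sum_i f i) p by exact: differentiable_sum.
rewrite E; apply/row_matrixP => l; rewrite !rowE.
rewrite -(deriveEjacobian _ dsum).
have dv i : derivable (f i) p (delta_mx 0 l) by exact: diff_derivable (df i).
rewrite (derive_sum dv).
rewrite mulmx_sumr; apply: eq_bigr => i _.
exact: (deriveEjacobian _ (df i)).
Qed.

Section Mean.
Context d (T : measurableType d) (R : realType) (P : probability T R).
Implicit Types X Y : T -> R.

Lemma meanE X : mean P X = (\int[P]_w X w)%R.
Proof. by rewrite /mean unlock. Qed.

Lemma has_mean_measurable X : has_mean P X -> measurable_fun setT X.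
Proof. by move=> iX; apply/measurable_EFinP; exact: measurable_int iX. Qed.

Lemma has_meanD X Y : has_mean P X -> has_mean P Y -> has_mean P (fun w => X w + Y w).
Proof. by move=> iX iY; exact: (integrableD measurableT iX iY). Qed.

Lemma has_meanB X Y : has_mean P X -> has_mean P Y -> has_mean P (fun w => X w - Y w).
Proof. by move=> iX iY; exact: (integrableB measurableT iX iY). Qed.

Lemma has_meanZ c X : has_mean P X -> has_mean P (fun w => c * X w).
Proof. by move=> iX; exact: (integrableZl measurableT c iX). Qed.

Lemma has_mean_cst c : has_mean P (fun => c).
Proof. exact: finite_measure_integrable_cst. Qed.

Lemma has_mean_sum (I : Type) (r : seq I) (X : I -> T -> R) :
  (forall i, has_mean P (X i)) -> has_mean P (fun w => \sum_(i <- r) X i w).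
Proof.
move=> iX; elim: r => [|i r ih].
  by under eq_fun do rewrite big_nil; exact: has_mean_cst.
by under eq_fun do rewrite big_cons; exact: has_meanD.
Qed.

Lemma meanD X Y : has_mean P X -> has_mean P Y ->
  mean P (fun w => X w + Y w) = mean P X + mean P Y.
Proof. by move=> iX iY; rewrite !meanE RintegralD. Qed.

Lemma meanB X Y : has_mean P X -> has_mean P Y ->
  mean P (fun w => X w - Y w) = mean P X - mean P Y.
Proof. by move=> iX iY; rewrite !meanE RintegralB. Qed.

Lemma meanZ c X : has_mean P X -> mean P (fun w => c * X w) = c * mean P X.
Proof. by move=> iX; rewrite !meanE RintegralZl. Qed.

Lemma mean_cst c : mean P (fun => c) = c.
Proof. by rewrite meanE Rintegral_cst//= probability_setT mulr1. Qed.

Lemma mean_sum (I : Type) (r : seq I) (X : I -> T -> R) :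
  (forall i, has_mean P (X i)) ->
  mean P (fun w => \sum_(i <- r) X i w) = \sum_(i <- r) mean P (X i).
Proof.
move=> iX; elim: r => [|i r ih].
  by under eq_fun do rewrite big_nil; rewrite big_nil mean_cst.
under eq_fun do rewrite big_cons; rewrite big_cons meanD ?ih//.
exact: has_mean_sum.
Qed.

Lemma le_mean X Y : has_mean P X -> has_mean P Y -> (forall w, X w <= Y w) ->
  mean P X <= mean P Y.
Proof. by move=> iX iY XY; rewrite !meanE; apply: le_Rintegral. Qed.

Lemma eq_mean X Y : X =1 Y -> mean P X = mean P Y.
Proof. by move=> /funext ->. Qed.

Lemma has_mean_bounded X c : measurable_fun setT X -> (forall w, `|X w| <= c) -> has_mean P X.
Proof.
move=> mX Xc; apply: (le_integrable measurableT _ _ (has_mean_cst c)).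
  exact/measurable_EFinP.
by move=> w _; rewrite lee_fin (le_trans (Xc w))// ler_norm.
Qed.

Lemma covariance0_mean X Y : has_mean P X -> has_mean P Y -> has_mean P (fun w => X w * Y w) ->
  covariance P X Y = 0%E -> mean P (fun w => X w * Y w) = mean P X * mean P Y.
Proof.
move=> /Lfun1_integrable iX /Lfun1_integrable iY /Lfun1_integrable iXY.
rewrite covarianceE// => h.
rewrite -(fineK (expectation_fin_num iX)) -(fineK (expectation_fin_num iY)) in h.
rewrite -(fineK (expectation_fin_num iXY)) -EFinM -EFinB in h.
by case: h => /eqP; rewrite subr_eq0 => /eqP.
Qed.

End Mean.

Section Coordinates.
Context {R : realType} {N : nat}.

Lemma measurable_coord (k : 'I_N) :
  measurable_fun [set: borel R N] (fun x : borel R N => (x : 'rV[R]_N) 0 k).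
Proof.
apply: (measurability _ (RGenOpens.measurableE R)).
move=> _ [_ [a [b ->] <-]]; rewrite setTI; apply: sub_sigma_algebra.
have := @coord_continuous R 1 N 0 k => /continuousP; apply; exact: interval_open.
Qed.

Lemma discharge_bounded (th : R) (s : 'rV[R]_N) k : discharge th s -> `|s 0 k| <= th.
Proof.
move=> ds.
pose S (j : 'I_N) := \sum_(t < N | (t <= j)%N) s 0 t.
have hS j : - th <= S j <= 0.
  by have := ds j; rewrite -/(S j) => /andP[? ?]; apply/andP; split; lra.
have th0 : 0 <= th by have /andP[a b] := ds k; exact: le_trans a b.
have Sk : S k = s 0 k + \sum_(t < N | (t < k)%N) s 0 t.
  rewrite /S (bigD1 k)//=; congr (_ + _); apply: eq_bigl => t.
  by rewrite ltn_neqAle andbC.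
have rest : - th <= \sum_(t < N | (t < k)%N) s 0 t <= 0.
  case: (posnP k) => [k0|k0].
    rewrite big_pred0; first by rewrite lexx andbT oppr_le0.
    by move=> t; rewrite k0.
  have kN : (k.-1 < N)%N by rewrite (leq_ltn_trans (leq_pred k)).
  have := hS (Ordinal kN); rewrite /S /=.
  by under eq_bigl do rewrite -ltnS prednK//.
have := hS k; rewrite Sk ler_norml => /andP[? ?]; case/andP: rest => ? ?.
by apply/andP; split; lra.
Qed.

End Coordinates.

(** * Surplus under a two-part tariff *)

Section MarketTheory.
Context d (T : measurableType d) (R : realType) (P : probability T R) (N M : nat)
  (m : market T R N M) (Pi : set 'rV[R]_N).
Hypothesis Pi_open : open Pi.
Hypothesis Pi_convex : convex_set (Pi : set (convex_lmodType 'rV[R]_N)).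
Hypothesis Pi_mean : Pi (mean_price P m).
Hypothesis Hdata : random_data m.
Hypothesis Hmoments : finite_moments_on P m Pi.
Hypothesis Hopt : demand_optimal_on P m Pi.
Hypothesis Hreg : demand_regular_on m Pi.
Hypothesis Hres : resources m.
Hypothesis Huncorr : uncorrelated_on P m Pi.

Implicit Types (i : 'I_M) (p : 'rV[R]_N) (t : two_part R N).
Local Notation mp := (mean_price P m).
Local Notation rnw i := (fun w => ren m i (om m i w)).

Let has_mean_lam j : has_mean P (fun w => lam m w 0 j).
Proof. by case: Hmoments. Qed.

Let has_mean_demand i p k : Pi p -> has_mean P (fun w => demand m i p w 0 k).
Proof. by case: Hmoments => _ _ h _ /(h i p) /(_ k)[]. Qed.

Let has_mean_dot (X : T -> 'rV[R]_N) p : (forall k, has_mean P (fun w => X w 0 k)) ->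
  has_mean P (fun w => dot p (X w)).
Proof.
move=> hX; under eq_fun do rewrite dotE.
by apply: has_mean_sum => k; exact: has_meanZ.
Qed.

Let has_mean_lam_dot (X : T -> 'rV[R]_N) :
  (forall k j, has_mean P (fun w => lam m w 0 j * X w 0 k)) ->
  has_mean P (fun w => dot (lam m w) (X w)).
Proof. by move=> hX; under eq_fun do rewrite dotE; exact: has_mean_sum. Qed.

Let has_mean_dot_demand i p q : Pi p -> has_mean P (fun w => dot q (demand m i p w)).
Proof. by move=> Pp; apply: has_mean_dot => k; exact: has_mean_demand. Qed.

Let has_mean_lam_demand i p : Pi p -> has_mean P (fun w => dot (lam m w) (demand m i p w)).
Proof.
by move=> Pp; apply: has_mean_lam_dot => k j; case: Hmoments => _ _ /(_ i p Pp k)[].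
Qed.

Let has_mean_dot_ren i q : has_mean P (fun w => dot q (ren m i (om m i w))).
Proof. by apply: has_mean_dot => k; case: Hmoments => _ /(_ i k)[]. Qed.

Let has_mean_lam_ren i : has_mean P (fun w => dot (lam m w) (ren m i (om m i w))).
Proof. by apply: has_mean_lam_dot => k j; case: Hmoments => _ /(_ i k)[_]. Qed.

Let has_mean_lam_cst (s : 'rV[R]_N) : has_mean P (fun w => dot (lam m w) s).
Proof. by under eq_fun do rewrite dotC; exact: has_mean_dot. Qed.

Lemma mean_lam_cst (s : 'rV[R]_N) : mean P (fun w => dot (lam m w) s) = dot mp s.
Proof.
under eq_mean do rewrite dotE.
rewrite mean_sum; last first.
  by move=> k; under eq_fun do rewrite mulrC; exact: has_meanZ.
rewrite dotE; apply: eq_bigr => k _; under eq_mean do rewrite mulrC.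
by rewrite meanZ// mxE mulrC.
Qed.

Let benefit_dem i p := benefit_net m i p (dem m i p).

Let has_mean_benefit_dem i p : Pi p -> has_mean P (benefit_dem i p).
Proof. by move=> Pp; have [[]] := Hopt i Pp. Qed.

Let margin i p w := dot p (demand m i p w) - dot (lam m w) (demand m i p w).

Let has_mean_margin i p : Pi p -> has_mean P (margin i p).
Proof. by move=> Pp; apply: has_meanB; [exact: has_mean_dot_demand|exact: has_mean_lam_demand]. Qed.

Lemma sw0E p : Pi p ->
  sw0 P m p = \sum_i (mean P (benefit_dem i p) + mean P (margin i p)).
Proof.
move=> Pp; apply: eq_bigr => i _.
rewrite -meanD; [|exact: has_mean_benefit_dem|exact: has_mean_margin].
apply: eq_mean => w; rewrite /benefit_dem /benefit_net /margin -/(demand m i p w).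
by rewrite addrA subrK.
Qed.

Lemma cs0_rs0 t : Pi (price t) -> cs0 P m t + rs0 P m t = sw0 P m (price t).
Proof.
move=> Pp; rewrite /cs0 /rs0 addrA subrK sw0E// big_split /=; congr (_ + _).
by apply: eq_bigr => i _; apply: eq_mean => w; rewrite dotBl.
Qed.

Lemma VS_sstar p th : 0 <= th -> VS p th = dot p (sstar m p th).
Proof.
move=> th0; have [_ _ /(_ p th th0)[ds ub]] := Hres.
apply: max_sup; first by exists (sstar m p th).
by move=> _ [s hs <-]; exact: ub.
Qed.

Let theta_ge0 i : 0 <= theta m i. Proof. by case: Hres. Qed.

Let sstar_le p i : dot mp (sstar m p (theta m i)) <= VS mp (theta m i).
Proof.
rewrite VS_sstar//; have [_ _ h] := Hres.
by apply: (h mp _ (theta_ge0 i)).2; exact: (h p _ (theta_ge0 i)).1.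
Qed.

Let measurable_om i : measurable_fun setT (om m i : T -> borel R N).
Proof. by case: Hdata. Qed.

Let has_mean_storage i p (s : 'rV[R]_N -> 'rV[R]_N) : policy s ->
  (forall w, discharge (theta m i) (s (om m i w))) ->
  has_mean P (fun w => dot p (s (om m i w))).
Proof.
move=> [ms _] ds; apply: has_mean_dot => k; apply: (@has_mean_bounded _ _ _ _ _ (theta m i)).
  apply: (measurableT_comp (measurable_coord k)).
  exact: (measurableT_comp ms (measurable_om i)).
by move=> w; exact: discharge_bounded.
Qed.

Let payoffE i t q s w : payoff m i (charge t) q s w =
  benefit_net m i (price t) q w - access t + dot (price t) (ren m i (om m i w))
  + dot (price t) (s (om m i w)).
Proof. by rewrite /payoff /charge /benefit_net !dotBr; ring. Qed.

Let payoff_funE i t q s : payoff m i (charge t) q s = fun w =>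
  benefit_net m i (price t) q w - access t + dot (price t) (ren m i (om m i w))
  + dot (price t) (s (om m i w)).
Proof. by apply/funext => w; exact: payoffE. Qed.

(** Consumption and storage separate under an affine tariff. Storage cannot gain from
    randomness: a discharge is feasible in every state, so [VS] bounds its value state by
    state and a constant discharge attains the bound. *)
Lemma cs_customerE i t : Pi (price t) -> cs_customer P m i (charge t) =
  mean P (benefit_dem i (price t)) - access t
  + mean P (fun w => dot (price t) (ren m i (om m i w))) + VS (price t) (theta m i).
Proof.
move=> Pp; set p := price t; apply: max_sup.
- have [_ _ /(_ p _ (theta_ge0 i))[ds _]] := Hres.
  exists (dem m i p), (fun=> sstar m p (theta m i)); split.
    split.
    + by have [[]] := Hopt i Pp.
    + by split; [exact: measurable_cst|].
    + by [].
    + rewrite payoff_funE.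
      apply: has_meanD; last exact: has_mean_cst.
      apply: has_meanD => //; apply: has_meanB; last exact: has_mean_cst.
      exact: has_mean_benefit_dem.
  rewrite payoff_funE.
  rewrite meanD; last exact: has_mean_cst.
    rewrite meanD//; last first.
      by apply: has_meanB; [exact: has_mean_benefit_dem|exact: has_mean_cst].
    rewrite meanB; [|exact: has_mean_benefit_dem|exact: has_mean_cst].
    by rewrite !mean_cst VS_sstar.
  apply: has_meanD => //; apply: has_meanB; last exact: has_mean_cst.
  exact: has_mean_benefit_dem.
move=> _ [q [s [[pq ps ds hp] ->]]].
have hs := has_mean_storage p ps ds.
have hr := has_mean_dot_ren i p.
have hq : has_mean P (benefit_net m i p q).
  rewrite (_ : benefit_net m i p q = fun w => payoff m i (charge t) q s w + access t
     - dot p (ren m i (om m i w)) - dot p (s (om m i w))).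
    apply: has_meanB => //; apply: has_meanB => //.
    by apply: has_meanD => //; exact: has_mean_cst.
  by apply/funext => w; rewrite payoffE -/p; ring.
rewrite payoff_funE.
have hqa : has_mean P (fun w => benefit_net m i p q w - access t).
  by apply: has_meanB => //; exact: has_mean_cst.
rewrite meanD//; last exact: has_meanD.
rewrite meanD// meanB//; last exact: has_mean_cst.
rewrite mean_cst; apply: lerD; first by rewrite lerD2r lerD2r; apply: (Hopt i Pp).2.
rewrite -(mean_cst P (VS p (theta m i))); apply: le_mean => //; first exact: has_mean_cst.
by move=> w; rewrite VS_sstar//; have [_ _ /(_ p _ (theta_ge0 i))[_]] := Hres; apply.
Qed.

Let net_margin i t w : charge t (net_demand m i (price t) w) -
    dot (lam m w) (net_demand m i (price t) w) =
  access t + margin i (price t) w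
  - (dot (price t) (ren m i (om m i w)) - dot (lam m w) (ren m i (om m i w)))
  - (dot (price t) (sstar m (price t) (theta m i)) -
     dot (lam m w) (sstar m (price t) (theta m i))).
Proof. by rewrite /charge /net_demand /margin !dotBr; ring. Qed.

Lemma rsE t : Pi (price t) -> rs P m t = M%:R * access t + \sum_i
  (mean P (margin i (price t))
   - (mean P (fun w => dot (price t) (ren m i (om m i w))) -
      mean P (fun w => dot (lam m w) (ren m i (om m i w))))
   - (VS (price t) (theta m i) - dot mp (sstar m (price t) (theta m i)))).
Proof.
move=> Pp; have Hm i := has_mean_margin i Pp.
have h1 i : has_mean P (fun w => access t + margin i (price t) w).
  by apply: has_meanD => //; exact: has_mean_cst.
have h2 i : has_mean P (fun w => dot (price t) (ren m i (om m i w)) -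
    dot (lam m w) (ren m i (om m i w))) by exact: has_meanB.
have h3 i : has_mean P (fun w => dot (price t) (sstar m (price t) (theta m i)) -
    dot (lam m w) (sstar m (price t) (theta m i))).
  by apply: has_meanB => //; exact: has_mean_cst.
rewrite /rs; under eq_mean do under eq_bigr do rewrite net_margin.
rewrite mean_sum; last by move=> i; do 2 apply: has_meanB => //.
rewrite mulr_natl -[in access t *+ M](card_ord M) -sumr_const -big_split /=.
apply: eq_bigr => i _; rewrite meanB//; last exact: has_meanB.
rewrite meanB// meanD//; last exact: has_mean_cst.
rewrite meanB// meanB//; last exact: has_mean_cst.
by rewrite !mean_cst mean_lam_cst VS_sstar// !addrA.
Qed.

(** The access charge and the payments cancel. The price only matters through [sw0] and
    through the discharge it induces, which is valued at the mean wholesale price. *)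
Lemma swE t : Pi (price t) -> sw P m t = sw0 P m (price t) +
  \sum_i (dot mp (sstar m (price t) (theta m i)) +
    mean P (fun w => dot (lam m w) (ren m i (om m i w)))).
Proof.
move=> Pp; rewrite /sw rsE// sw0E//.
rewrite mulr_natl -[in access t *+ M](card_ord M) -sumr_const /cs -!big_split /=.
by apply: eq_bigr => i _; rewrite cs_customerE//; ring.
Qed.

Let jacobian_totalE w p : Pi p ->
  'J (fun p => total_demand m p w) p = \sum_i 'J (fun p => demand m i p w) p.
Proof. by move=> Pp; apply: jacobian_sum => i; case: (Hreg i w Pp). Qed.

Let differentiable_total w p : Pi p -> differentiable (fun p => total_demand m p w) p.
Proof.
move=> Pp; have -> : (fun p => total_demand m p w) = \sum_i (fun p => demand m i p w).
  by apply/funext => x; rewrite fct_sumE.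
by apply: differentiable_sum => i; case: (Hreg i w Pp).
Qed.

Let continuous_jacobian_total w p : Pi p ->
  {for p, continuous (fun p => 'J (fun p => total_demand m p w) p)}.
Proof.
move=> Pp.
have near_sum : \forall x \near p, \sum_i 'J (fun p => demand m i p w) x =
    'J (fun p => total_demand m p w) x.
  by apply: filterS (open_nbhs_nbhs (conj Pi_open Pp)) => x Px; rewrite jacobian_totalE.
have cs : \sum_i 'J (fun p => demand m i p w) x @[x --> p] -->
    \sum_i 'J (fun p => demand m i p w) p.
  by apply: (cvg_big add_continuous (nbhs_filter p)) => i _; case: (Hreg i w Pp).
rewrite /prop_for /continuous_at jacobian_totalE//.
exact: cvg_trans (@near_eq_cvg _ _ (nbhs p) (nbhs_filter p) _ _ near_sum) cs.
Qed.

Let negative_jacobian_total w p : Pi p ->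
  forall v, dot (v *m 'J (fun p => total_demand m p w) p) v <= 0.
Proof.
move=> Pp v; rewrite jacobian_totalE// mulmx_sumr dot_suml; apply: sumr_le0 => i _.
have [->|v0] := eqVneq v 0; first by rewrite mul0mx dot0l.
by apply: ltW; have [_ _ _] := Hreg i w Pp; apply.
Qed.

Let dev k w := lam m w 0 k - mp 0 k.

Let has_mean_dev k : has_mean P (dev k).
Proof. by apply: has_meanB => //; exact: has_mean_cst. Qed.

Let has_mean_total p k : Pi p -> has_mean P (fun w => total_demand m p w 0 k).
Proof.
move=> Pp; under eq_fun do rewrite summxE; apply: has_mean_sum => i.
exact: has_mean_demand.
Qed.

Let has_mean_dev_total p j k : Pi p -> has_mean P (fun w => dev j w * total_demand m p w 0 k).
Proof.
move=> Pp; under eq_fun do rewrite mulrBl; apply: has_meanB; last first.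
  by apply: has_meanZ; exact: has_mean_total.
under eq_fun do rewrite summxE mulr_sumr; apply: has_mean_sum => i.
by case: Hmoments => _ _ /(_ i p Pp k)[].
Qed.

Let has_mean_grad p l k : Pi p -> has_mean P (fun w => grad_demand m p w l k).
Proof. by move=> Pp; case: Hmoments => _ _ _ /(_ p Pp l k)[]. Qed.

Let has_mean_lam_grad p j l k : Pi p -> has_mean P (fun w => lam m w 0 j * grad_demand m p w l k).
Proof. by move=> Pp; case: Hmoments => _ _ _ /(_ p Pp l k)[]. Qed.

Let has_mean_dev_grad p j l k : Pi p -> has_mean P (fun w => dev j w * grad_demand m p w l k).
Proof.
move=> Pp; under eq_fun do rewrite mulrBl; apply: has_meanB; first exact: has_mean_lam_grad.
by apply: has_meanZ; exact: has_mean_grad.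
Qed.

Let mean_dev_grad p j l k : Pi p -> mean P (fun w => dev j w * grad_demand m p w l k) = 0.
Proof.
move=> Pp; under eq_mean do rewrite mulrBl.
have hg := has_mean_grad l k Pp; have hlg := has_mean_lam_grad j l k Pp.
rewrite meanB//; last exact: has_meanZ.
rewrite meanZ//; under eq_mean do rewrite mulrC.
rewrite (covariance0_mean hg (has_mean_lam j)) ?mxE; first by rewrite mulrC subrr.
  by under eq_fun do rewrite mulrC.
exact: Huncorr.
Qed.

Lemma mean_dev_total_constant p p' k : Pi p -> Pi p' ->
  mean P (fun w => dev k w * total_demand m p w 0 k) =
  mean P (fun w => dev k w * total_demand m p' w 0 k).
Proof.
move=> Pp Pp'; rewrite !meanE /Rintegral; congr fine.
apply: (@weighted_mean_constant _ T R P N Pi (dev k) (fun w p => total_demand m p w)).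
- exact: Pi_open.
- exact: Pi_convex.
- exact: differentiable_total.
- exact: continuous_jacobian_total.
- exact: negative_jacobian_total.
- exact: has_mean_measurable (has_mean_dev k).
- by move=> q Pq j; exact: has_mean_measurable (has_mean_total j Pq).
- by move=> q Pq l j; exact: has_mean_measurable (has_mean_grad l j Pq).
- exact: has_mean_dev.
- by move=> q Pq j; exact: has_mean_dev_total.
- by move=> q Pq l j; exact: has_mean_dev_grad.
- move=> q Pq l j; have := mean_dev_grad k l j Pq; rewrite meanE /Rintegral => h.
  rewrite -[LHS]fineK ?h//; exact: integrable_fin_num (has_mean_dev_grad k l j Pq).
- exact: Pp.
- exact: Pp'.
Qed.

Let spread p w := dot (lam m w - mp) (total_demand m p w).

Let mean_spreadE p : Pi p ->
  mean P (spread p) = \sum_k mean P (fun w => dev k w * total_demand m p w 0 k).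
Proof.
move=> Pp; rewrite -mean_sum; last by move=> k; exact: has_mean_dev_total.
by apply: eq_mean => w; rewrite /spread dotE; apply: eq_bigr => k _; rewrite /dev !mxE.
Qed.

Let mean_spread_constant p : Pi p -> mean P (spread p) = mean P (spread mp).
Proof.
move=> Pp; rewrite !mean_spreadE//; apply: eq_bigr => k _.
exact: mean_dev_total_constant.
Qed.

Let has_mean_gap i p q : Pi p -> has_mean P (fun w => dot (q - mp) (demand m i p w)).
Proof. by move=> Pp; exact: has_mean_dot_demand. Qed.

Let sum_margin p : Pi p -> \sum_i mean P (margin i p) =
  \sum_i mean P (fun w => dot (p - mp) (demand m i p w)) - mean P (spread p).
Proof.
move=> Pp.
have hs i : has_mean P (fun w => dot (lam m w - mp) (demand m i p w)).
  by under eq_fun do rewrite dotBl; apply: has_meanB;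
    [exact: has_mean_lam_demand|exact: has_mean_dot_demand].
have -> : mean P (spread p) = \sum_i mean P (fun w => dot (lam m w - mp) (demand m i p w)).
  rewrite -mean_sum//; apply: eq_mean => w.
  by rewrite /spread dotC dot_suml; apply: eq_bigr => i _; exact: dotC.
rewrite -sumrB; apply: eq_bigr => i _; rewrite -meanB//; last exact: has_mean_gap.
by apply: eq_mean => w; rewrite /margin !dotBl; ring.
Qed.

(** Revealed preference: at the mean price, the demand for another price [p] is an
    available policy. Compared with the total surplus at [p], what it brings to the
    customers differs by the covariances of demand and wholesale price at [p], which are
    the same at all prices ([mean_dev_total_constant]). *)
Lemma sw0_le_mean_price p : Pi p -> sw0 P m p <= sw0 P m mp.
Proof.
move=> Pp; rewrite !sw0E// !big_split /= !sum_margin// (mean_spread_constant Pp).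
rewrite [X in _ <= _ + (X - _)](_ : _ = 0); last first.
  apply: big1 => i _; rewrite -[RHS](mean_cst P 0); apply: eq_mean => w.
  by rewrite subrr dot0l.
rewrite sub0r addrA lerD2r -big_split /=; apply: ler_sum => i _.
rewrite -meanD; [|exact: has_mean_benefit_dem|exact: has_mean_gap].
have E : (fun w => benefit_dem i p w + dot (p - mp) (demand m i p w)) =
    benefit_net m i mp (dem m i p).
  by apply/funext => w; rewrite /benefit_dem /benefit_net -/(demand m i p w) dotBl; ring.
rewrite E; apply: (Hopt i Pi_mean).2; split; first by have [[]] := Hopt i Pp.
by rewrite -E; apply: has_meanD; [exact: has_mean_benefit_dem|exact: has_mean_gap].
Qed.

Let sw_mean_price A : sw P m (TwoPart A mp) = sw0 P m mp + \sum_i (VS mp (theta m i) +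
  mean P (fun w => dot (lam m w) (ren m i (om m i w)))).
Proof.
by rewrite swE//; congr (_ + _); apply: eq_bigr => i _; rewrite VS_sstar.
Qed.

Let no_customer (I : 'I_M -> R) : M = 0%N -> \sum_i I i = 0.
Proof. by move=> M0; apply: big1 => -[i iM]; exfalso; move: iM; rewrite M0. Qed.

(** The revenue constraint fixes the difference between total and consumer surplus, and
    the access charge can meet it at the mean price, where total surplus is maximal:
    an optimal tariff reaches this maximum. *)
Lemma sw_optimal F t : optimal_tariff Pi (cs P m) (rs P m) F t ->
  sw P m t = sw0 P m mp + \sum_i (VS mp (theta m i) +
    mean P (fun w => dot (lam m w) (ren m i (om m i w)))).
Proof.
move=> [Pt rst tmax].
have [M0|M0] := posnP M; first by rewrite swE// /sw0 !no_customer.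
apply/eqP; rewrite eq_le; apply/andP; split.
  rewrite swE//; apply: lerD; first exact: sw0_le_mean_price.
  by apply: ler_sum => i _; rewrite lerD2r; exact: sstar_le.
pose A := (F - (rs P m (TwoPart 0 mp))) / M%:R.
have rsA : rs P m (TwoPart A mp) = F.
  rewrite rsE//= mulrCA divff ?mulr1 ?pnatr_eq0 ?gtn_eqF//.
  by rewrite rsE//= mulr0 add0r subrK.
rewrite -(sw_mean_price A) /sw rst rsA lerD2r; exact: tmax.
Qed.

Lemma sw0_optimal F t : optimal_tariff Pi (cs0 P m) (rs0 P m) F t ->
  sw0 P m (price t) = sw0 P m mp.
Proof.
move=> [Pt rst tmax].
have [M0|M0] := posnP M; first by rewrite /sw0 !no_customer.
apply/eqP; rewrite eq_le sw0_le_mean_price//=.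
pose A := (F - (rs0 P m (TwoPart 0 mp))) / M%:R.
have rsA : rs0 P m (TwoPart A mp) = F.
  rewrite /rs0 /= mulrCA divff ?mulr1 ?pnatr_eq0 ?gtn_eqF//.
  by rewrite /A /rs0 /= mulr0 add0r subrK.
rewrite -(cs0_rs0 Pt) rst -[leLHS](@cs0_rs0 (TwoPart A mp))// rsA lerD2r.
exact: tmax.
Qed.

End MarketTheory.

Theorem corollary1 (d : measure_display) (T : measurableType d) (R : realType)
    (P : probability T R) (N M : nat) (m : market T R N M)
    (Pi : set 'rV[R]_N)
    (Pi_open : open Pi)
    (Pi_convex : convex_set (Pi : set (convex_lmodType 'rV[R]_N)))
    (Pi_mean : Pi (mean_price P m))
    (Hdata : random_data m)
    (Hmoments : finite_moments_on P m Pi)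
    (Hopt : demand_optimal_on P m Pi)
    (Hreg : demand_regular_on m Pi)
    (Hfoc : foc_regular_on P m Pi)
    (Hres : resources m)
    (Huncorr : uncorrelated_on P m Pi) :
  [/\ forall (F : R) (Tdec T0 : two_part R N),
        optimal_tariff Pi (cs P m) (rs P m) F Tdec ->
        optimal_tariff Pi (cs0 P m) (rs0 P m) F T0 ->
        sw P m Tdec = sw0 P m (price T0) +
          \sum_(i < M) (VS (mean_price P m) (theta m i) +
             mean P (fun w => dot (lam m w) (ren m i (om m i w)))),
      forall (F F' : R) (Tdec Tdec' : two_part R N),
        optimal_tariff Pi (cs P m) (rs P m) F Tdec ->
        optimal_tariff Pi (cs P m) (rs P m) F' Tdec' ->
        sw P m Tdec = sw P m Tdec' &
      forall (F : R) (Tdec T0 : two_part R N),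
        optimal_tariff Pi (cs P m) (rs P m) F Tdec ->
        optimal_tariff Pi (cs0 P m) (rs0 P m) F T0 ->
        cs P m Tdec = cs0 P m T0 +
          \sum_(i < M) (VS (mean_price P m) (theta m i) +
             mean P (fun w => dot (lam m w) (ren m i (om m i w))))].
Proof.
have W F t := @sw_optimal _ _ _ _ _ _ _ _ Pi_open Pi_convex Pi_mean Hdata Hmoments Hopt Hreg
  Hres Huncorr F t.
have W0 F t := @sw0_optimal _ _ _ _ _ _ _ _ Pi_open Pi_convex Pi_mean Hmoments Hopt Hreg
  Huncorr F t.
split=> [F Tdec T0 h h0|F F' Tdec Tdec' h h'|F Tdec T0 h h0].
- by rewrite (W _ _ h) (W0 _ _ h0).
- by rewrite (W _ _ h) (W _ _ h').
have [_ hF _] := h; have [P0 h0F _] := h0.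
apply: (addIr F); rewrite -[in LHS]hF -/(sw P m Tdec) (W _ _ h) addrAC -[in RHS]h0F.
by rewrite (cs0_rs0 Hmoments Hopt P0) (W0 _ _ h0).
Qed.
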